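(* For every fixed $0<d\le 1/2$ and $\varepsilon>0$, if $p=n^{-(2/5+\varepsilon)}$, then there is a sequence $(G_n)$ with $G_n\in\mathscr{G}_{d,n}$ such that asymptotically almost surely $G_n\cup\mathbb{G}(n,p)$ does not satisfy $\xrightarrow{\mathrm{rbw}}K_8$, i.e. it admits a proper edge-colouring with no rainbow copy of $K_8$.
   Context: For graphs $G,H$, write $G \xrightarrow{\mathrm{rbw}} H$ if every proper edge-colouring of $G$ contains a rainbow copy of $H$ (a subgraph all of whose edges receive distinct colours). $\mathbb{G}(n,p)$ is the binomial random graph. $\mathscr{G}_{d,n}$ denotes the family of $n$-vertex graphs with edge density at least $d$. $G\cup\mathbb{G}(n,p)$ denotes the union of a fixed $n$-vertex graph $G$ with an independent random graph $\mathbb{G}(n,p)$ on the same vertex set. ''Asymptotically almost surely'' means with probability tending to $1$ as $n\to\infty$. *)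

(* Defs.v *)
From HB Require Import structures.
From mathcomp Require Import all_boot all_order all_algebra.
From mathcomp Require Import all_classical all_reals all_analysis.
Set Implicit Arguments. Unset Strict Implicit. Unset Printing Implicit Defensive.
Import Order.TTheory GRing.Theory Num.Theory.
Local Open Scope ring_scope.

Definition pairs (n : nat) : {set {set 'I_n}} := [set e : {set 'I_n} | #|e| == 2%N].

Definition is_graph n (E : {set {set 'I_n}}) : Prop := E \subset pairs n.

Definition in_dense_family {R : realType} (d : R) n (E : {set {set 'I_n}}) : Prop :=
  is_graph E /\ d * ('C(n, 2))%:R <= (#|E|)%:R.

Definition proper_colouring n (E : {set {set 'I_n}}) (c : {set 'I_n} -> nat) : Prop :=
  forall e f, e \in E -> f \in E -> e != f -> ~~ [disjoint e & f] -> c e <> c f.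

Definition rainbow_clique n (E : {set {set 'I_n}}) (c : {set 'I_n} -> nat) (k : nat) : Prop :=
  exists S : {set 'I_n}, #|S| = k /\
    (forall x y, x \in S -> y \in S -> x != y -> [set x; y] \in E) /\
    {in [set e in pairs n | e \subset S] &, injective c}.

Definition rbw_arrows_K n (E : {set {set 'I_n}}) (k : nat) : Prop :=
  forall c, proper_colouring E c -> rainbow_clique E c k.

Definition gnp_prob {R : realType} (n : nat) (p : R) (P : {set {set 'I_n}} -> Prop) : R :=
  \sum_(F in powerset (pairs n))
     (if `[< P F >] then p ^+ #|F| * (1 - p) ^+ (#|pairs n| - #|F|) else 0).

(* Main.v *)
(* [G] is the complete bipartite graph on two halves, whose edges get private colours.  An 8-clique
   has either 5 vertices in one half or 4 in each, so it is enough to find, asymptotically almost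
   surely, a proper colouring of the random edges inside the halves such that every 4-clique
   repeats a colour or contains an edge of one special colour 0 (a 5-clique then repeats a colour
   too: if colour 0 meets all its 4-cliques it occurs twice).

   Put f(S) = 5 |S| - 2 e(S).  As p = n^-(2/5 + eps), the first moment method gives f(S) >= 1 for
   all bounded nonempty S, and f(S) >= 9 once |S| exceeds a constant.  Link 4-cliques that share
   an edge.  A component is built from an edge, where f = 8, by adding pairs of vertices, which
   keeps f, or single vertices with d >= 3 earlier neighbours, which lowers f by 2d - 5 >= 1; so
   f <= 8 throughout and components are bounded.  Along the way one finds a proper colouring of the
   component with no rainbow 4-clique if f >= 6 and at most 6 - f of them otherwise.  Components
   with f <= 5 that touch form tree-like clusters, each new one meeting the previous ones in
   a single vertex; rooting each cluster at its smallest f, one chooses disjoint edges hitting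
   all the rainbow 4-cliques, and these edges receive colour 0. *)
Require Import Defs.
From HB Require Import structures.
From mathcomp Require Import all_boot all_order all_algebra.
From mathcomp Require Import all_classical all_reals all_analysis.
From mathcomp Require Import zify ring lra.
(* Re-imported so that their names are not shadowed by those of mathcomp-analysis. *)
From mathcomp Require Import fintype finset fingraph.
Import Order.TTheory GRing.Theory Num.Theory numFieldNormedType.Exports.
Set Implicit Arguments. Unset Strict Implicit. Unset Printing Implicit Defensive.

(** * Hitting sets with disjoint pairs *)

Section Hitting.
Variable V : finType.
Implicit Types (U A : {set V}) (M : {set {set V}}).

Definition disjoint_pairs M :=
  (forall e, e \in M -> #|e| = 2) /\
  (forall e f, e \in M -> f \in M -> e != f -> [disjoint e & f]).

Definition hits M U := exists2 e, e \in M & e \subset U.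

Lemma card_pair_sub A : 1 < #|A| -> exists2 e : {set V}, #|e| = 2 & e \subset A.
Proof.
move=> /card_gt1P [x [y [xA yA xy]]]; exists [set x; y]; first by rewrite cards2 xy.
by apply/subsetP => z; rewrite !inE => /orP[] /eqP->.
Qed.

(** The rotational tournament on [2 * m + 1] indices: [i] beats the [m] indices that follow it
    cyclically. *)
Definition beats m (i j : nat) := ((i < j) && (j <= i + m)) || (j + m < i).

Lemma beats_total m i j : i != j -> beats m i j || beats m j i.
Proof. rewrite /beats; lia. Qed.

Lemma beats_out m (i : 'I_(2 * m + 1)) :
  m <= 2 -> \sum_(j < 2 * m + 1) beats m i j <= m.
Proof.
by case: m i => [|[|[|//]]] [i ilt] _; rewrite !big_ord_recl big_ord0 /=;
  move: i ilt; do 6?case.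
Qed.

Lemma count_ge2 (T : Type) (x0 : T) (P : pred T) (s : seq T) i j :
  i < size s -> j < size s -> i != j -> P (nth x0 s i) -> P (nth x0 s j) -> 2 <= count P s.
Proof.
elim: s i j => [|x s IH] [|i] [|j] //=.
- rewrite ltnS => _ js _ ->; rewrite add1n ltnS => Pj.
  by rewrite -has_count; apply/(has_nthP x0); exists j.
- rewrite ltnS => is_ _ _ Pi ->; rewrite add1n ltnS.
  by rewrite -has_count; apply/(has_nthP x0); exists i.
- rewrite !ltnS eqSS => is_ js ij Pi Pj.
  by apply: leq_trans (IH i j is_ js ij Pi Pj) _; rewrite leq_addl.
Qed.

(* A regular tournament on the indices: every set gives up the points it shares
   with the sets it beats. *)
Lemma hitting_almost_disjoint m (Us : seq {set V}) :
  m <= 2 -> size Us <= 2 * m + 1 -> (forall U, U \in Us -> m + 2 <= #|U|) ->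
  (forall i j, i < size Us -> j < size Us -> i != j ->
     #|nth set0 Us i :&: nth set0 Us j| <= 1) ->
  exists M, [/\ disjoint_pairs M, forall e, e \in M -> exists2 U, U \in Us & e \subset U
    & forall U, U \in Us -> hits M U].
Proof.
move=> m2 sz big adis; set n := size Us; pose F (i : nat) := nth set0 Us i.
pose A (i : 'I_n) : {set V} := F i :\: \bigcup_(j < n | beats m i j) F j.
have A2 i : 1 < #|A i|.
  have Fi : m + 2 <= #|F i| by apply: big; apply: mem_nth.
  rewrite cardsD; suff: #|F i :&: \bigcup_(j < n | beats m i j) F j| <= m by lia.
  have lt_i : i < 2 * m + 1 by apply: leq_trans sz.
  have := @beats_out m (Ordinal lt_i) m2; apply: leq_trans.
  have -> : F i :&: \bigcup_(j < n | beats m i j) F j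
    = \bigcup_(j < n | beats m i j) (F i :&: F j).
    by rewrite big_distrr.
  apply: leq_trans (_ : \sum_(j < n | beats m i j) #|F i :&: F j| <= _).
    elim/big_rec2: _ => [|j k B _ IH]; first by rewrite cards0.
    by apply: leq_trans (leq_card_setU _ _) _; rewrite leq_add2l.
  apply: leq_trans (_ : \sum_(j < n) beats m i j <= _).
    rewrite big_mkcond; apply: leq_sum => j _; case: ifP => // bij.
    apply: adis => //; apply/eqP => ij; move: bij; rewrite ij /beats; lia.
  by rewrite -[X in X <= _](big_mkord xpredT (fun j => nat_of_bool (beats m i j)))
       -[X in _ <= X](big_mkord xpredT (fun j => nat_of_bool (beats m i j)))
       [X in _ <= X](big_cat_nat _ sz) //= leq_addr.
have Adis i j : i != j -> [disjoint A i & A j].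
  move=> ij; rewrite -setI_eq0; apply/eqP/setP => x; rewrite !inE.
  apply/negP => /andP[/andP[/bigcupP ni xi] /andP[/bigcupP nj xj]].
  have /orP[b|b] := @beats_total m i j ij.
    by apply: ni; exists j.
  by apply: nj; exists i.
have /fin_all_exists2[g g2 gA] i : exists2 e : {set V}, #|e| = 2 & e \subset A i.
  exact: card_pair_sub.
exists [set g i | i : 'I_n]; split; first split.
- by move=> e /imsetP[i _ ->].
- move=> e f /imsetP[i _ ->] /imsetP[j _ ->] gij.
  have ij : i != j by apply: contraNneq gij => ->.
  by apply: disjointWl (gA i) _; apply: disjointWr (gA j) _; apply: Adis.
- move=> e /imsetP[i _ ->]; exists (F i); first exact: mem_nth.
  by apply: subset_trans (gA i) _; apply: subsetDl.
- move=> U /(nthP set0)[i ilt <-]; exists (g (Ordinal ilt)); first exact: imset_f.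
  by apply: subset_trans (gA _) _; apply: subsetDl.
Qed.

(* A pair contained in two of the sets lowers both [m] and the sizes. *)
Lemma hitting m (Us : seq {set V}) :
  m <= 2 -> size Us <= 2 * m + 1 -> (forall U, U \in Us -> m + 2 <= #|U|) ->
  exists M, [/\ disjoint_pairs M, forall e, e \in M -> exists2 U, U \in Us & e \subset U
    & forall U, U \in Us -> hits M U].
Proof.
elim: m Us => [|m IHm] Us m2 sz big.
  apply: hitting_almost_disjoint big _ => // i j; lia.
have [/existsP[i /existsP[j /andP[ij /card_pair_sub[e e2]]]]|nex] :=
    boolP [exists i : 'I_(size Us), exists j : 'I_(size Us),
      (i != j) && (1 < #|nth set0 Us i :&: nth set0 Us j|)]; last first.
  apply: hitting_almost_disjoint m2 sz big _ => i j ilt jlt ij.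
  rewrite leqNgt; apply: contra nex => lt1.
  by apply/existsP; exists (Ordinal ilt); apply/existsP; exists (Ordinal jlt); rewrite -val_eqE /= ij.
rewrite subsetI => /andP[ei ej].
(* At least two sets contain [e] and are hit by it; each remaining set meets [e] in at most one
   point, so it loses at most one. *)
pose Us' := [seq U :\: e | U : {set V} <- [seq U : {set V} <- Us | ~~ (e \subset U)]].
have sz' : size Us' <= 2 * m + 1.
  pose P : pred {set V} := fun U => e \subset U.
  have := count_predC P Us; have := @count_ge2 _ set0 P Us i j (ltn_ord i) (ltn_ord j) ij ei ej.
  rewrite size_map size_filter.
  have -> : count (fun U : {set V} => ~~ (e \subset U)) Us = count (predC P) Us by [].
  lia.
have big' U : U \in Us' -> m + 2 <= #|U|.
  move=> /mapP[W]; rewrite mem_filter => /andP[eW WU] ->.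
  have lt2 : #|W :&: e| < 2.
    rewrite -e2; apply: proper_card; rewrite properEneq subsetIr andbT.
    by apply: contra eW => /eqP <-; apply: subsetIl.
  by rewrite cardsD; have := big _ WU; lia.
have [M [[M2 Mdis] Msub Mhit]] := IHm Us' (ltnW m2) sz' big'.
have Me f : f \in M -> [disjoint e & f].
  move=> /Msub[U /mapP[W _ ->]]; rewrite subsetD => /andP[_].
  by rewrite disjoint_sym.
exists (e |: M); split; first split.
- by move=> f /setU1P[->|/M2].
- move=> f g /setU1P[->|fM] /setU1P[->|gM]; rewrite ?eqxx //.
  + by move=> _; apply: Me.
  + by move=> _; rewrite disjoint_sym; apply: Me.
  + exact: Mdis.
- move=> f /setU1P[->|/Msub[U /mapP[W]]].
    by exists (nth set0 Us i) => //; apply: mem_nth.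
  rewrite mem_filter => /andP[_ WU] -> /subset_trans fW.
  by exists W => //; apply: fW; apply: subsetDl.
- move=> U UU; have [eU|eU] := boolP (e \subset U).
    by exists e => //; apply: setU11.
  have [|f fM fU] := Mhit (U :\: e).
    by apply: map_f; rewrite mem_filter eU.
  exists f; first by rewrite setU1r.
  by apply: subset_trans fU (subsetDl _ _).
Qed.

End Hitting.

(** * A matching for the dense components *)

Lemma exists_maximal (T : finType) (P : {set T} -> Prop) (A : {set T}) :
  P A -> exists2 B, P B & forall C, P C -> B \subset C -> C = B.
Proof.
move=> PA; have [|B /maxsetP[/asboolP PB maxB] _] := @maxset_exists _ (fun X => `[< P X >]) A.
  exact/asboolP.
by exists B => // C PC BC; apply: maxB => //; apply/asboolP.
Qed.

(** In a cluster, [R] is empty for the first component and the point of contact for a later one;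
    avoiding it keeps the new pairs disjoint from the earlier ones. *)
Lemma hitting_avoiding (V : finType) m (R : {set V}) (F : {set {set V}}) :
  m <= 2 -> #|F| <= 2 * m + 1 -> (forall U, U \in F -> m + 2 <= #|U :\: R|) ->
  exists M : {set {set V}}, [/\ disjoint_pairs M,
    forall e, e \in M -> exists2 U, U \in F & e \subset U :\: R
    & forall U, U \in F -> hits M U].
Proof.
move=> m2 cF big.
have [|U /mapP[W WF ->]|M [Mdis Msub Mhit]] := @hitting V m [seq U :\: R | U <- enum F] m2.
- by rewrite size_map -cardE.
- by apply: big; rewrite -mem_enum.
exists M; split=> // [e /Msub[U /mapP[W WF ->] eU]|U UF].
  by exists W; rewrite // -mem_enum.
have [|e eM eU] := Mhit (U :\: R); first by apply: map_f; rewrite mem_enum.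
by exists e => //; apply: subset_trans eU (subsetDl _ _).
Qed.

Lemma disjoint_pairsU (V : finType) (A B : {set V}) (M N : {set {set V}}) :
  disjoint_pairs M -> disjoint_pairs N ->
  (forall e, e \in M -> e \subset A) -> (forall e, e \in N -> e \subset B) ->
  [disjoint A & B] -> disjoint_pairs (M :|: N).
Proof.
move=> [M2 Mdis] [N2 Ndis] MA NB AB.
have MN e f : e \in M -> f \in N -> [disjoint e & f].
  by move=> /MA eA /NB fB; apply: disjointWl eA _; apply: disjointWr fB _.
split=> [e /setUP[/M2|/N2] //|e f /setUP[eM|eN] /setUP[fM|fN] ef].
- exact: Mdis.
- exact: MN.
- by rewrite disjoint_sym MN.
- exact: Ndis.
Qed.

Section Cluster.
Variables (V I : finType) (S : I -> {set V}) (w : I -> nat) (Us : I -> {set {set V}}).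
(* [S i] and [w i] are the vertex set and twice the number of edges of a component, [Us i] its
   rainbow 4-cliques; distinct components have disjoint edge sets. *)
Variables (D : {set I}) (h : nat).
Hypothesis S_small : forall i, i \in D -> #|S i| < h.
Hypothesis S_dense : forall i, i \in D -> 5 * #|S i| <= w i + 5.
Hypothesis Us_card : forall i, i \in D -> #|Us i| + (5 * #|S i| - w i) <= 6.
Hypothesis Us_sub : forall i U, i \in D -> U \in Us i -> (U \subset S i) && (#|U| == 4).
Let W (J : {set I}) := \bigcup_(i in J) S i.
Hypothesis sparse : forall J : {set I}, J \subset D -> J != set0 -> #|W J| < h ->
  \sum_(i in J) w i < 5 * #|W J|.
Hypothesis sparser : forall J : {set I}, J \subset D -> J != set0 -> h <= #|W J| <= 2 * h ->
  \sum_(i in J) w i + 8 < 5 * #|W J|.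

Let matched (J : {set I}) := exists M, [/\ disjoint_pairs M,
  forall e, e \in M -> exists i, [/\ i \in J, e \subset S i & exists2 U, U \in Us i & e \subset U]
  & forall i U, i \in J -> U \in Us i -> hits M U].

Let W1 i : W [set i] = S i.
Proof. by rewrite /W big_set1. Qed.

Let WU J K : W (J :|: K) = W J :|: W K.
Proof. by rewrite /W bigcup_setU. Qed.

Let match_sub (J : {set I}) (M : {set {set V}}) : (forall e, e \in M -> exists i,
    [/\ i \in J, e \subset S i & exists2 U, U \in Us i & e \subset U]) ->
  forall e, e \in M -> e \subset W J.
Proof.
by move=> Msub e /Msub[i [iJ eS _]]; apply: subset_trans eS _; apply: (bigcup_sup i).
Qed.

Let matchedU (J K : {set I}) : [disjoint W J & W K] -> matched J -> matched K -> matched (J :|: K).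
Proof.
move=> JK [M [Mdis Msub Mhit]] [N [Ndis Nsub Nhit]]; exists (M :|: N); split.
- exact: disjoint_pairsU Mdis Ndis (match_sub Msub) (match_sub Nsub) JK.
- move=> e /setUP[/Msub|/Nsub] [i [iJ eS eU]]; exists i; split=> //; rewrite inE iJ ?orbT //.
- move=> i U /setUP[iJ|iK] Ui.
    by have [e eM eU] := Mhit i U iJ Ui; exists e; rewrite // inE eM.
  by have [e eM eU] := Nhit i U iK Ui; exists e; rewrite // inE eM orbT.
Qed.

Let sparse1 i : i \in D -> w i < 5 * #|S i|.
Proof.
move=> iD; have := @sparse [set i]; rewrite sub1set W1 big_set1; apply => //.
  by apply/set0Pn; exists i; rewrite inE.
exact: S_small.
Qed.

(* [J] is grown from a densest item [i0]: every other item is at least as sparse as [i0],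
   so it meets the union in a single point and has few sets left to hit. *)
Let cluster_of i0 (D' : {set I}) : D' \subset D -> i0 \in D' ->
  (forall i, i \in D' -> 5 * #|S i0| - w i0 <= 5 * #|S i| - w i) ->
  exists J : {set I}, [/\ i0 \in J, J \subset D', matched J
    & forall i, i \in D' -> i \notin J -> [disjoint S i & W J]].
Proof.
move=> D'D i0D' min_i0.
have i0D := subsetP D'D _ i0D'.
(* Call [5 * #|S| - w] the excess. The numerical invariant says that the union has excess at most
   that of [i0]. *)
pose Q (J : {set I}) := [/\ i0 \in J, J \subset D', #|W J| < h,
  5 * #|W J| + w i0 <= \sum_(i in J) w i + 5 * #|S i0| & matched J].
have Q0 : Q [set i0].
  split; rewrite ?inE ?sub1set ?W1 ?big_set1 //; first exact: S_small.
    by rewrite addnC.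
  (* The excess of [i0] is at least 1, so at most five sets of size 4 must be hit. *)
  have [||U Ui|M [Mdis Msub Mhit]] := @hitting_avoiding V 2 set0 (Us i0).
  - by [].
  - by have := Us_card i0D; have := sparse1 i0D; clear; lia.
  - by rewrite setD0; have /andP[_ /eqP->] := Us_sub i0D Ui.
  exists M; split=> // [e /Msub[U Ui]|i U /set1P->]; last exact: Mhit.
  rewrite setD0 => eU; exists i0; rewrite inE eqxx; split=> //; last by exists U.
  by have /andP[US _] := Us_sub i0D Ui; apply: subset_trans eU US.
have [J QJ Jmax'] := exists_maximal Q0.
have Jmax i : i \notin J -> ~ Q (i |: J).
  by move=> /negP iJ /Jmax' /(_ (subsetUr _ _)) E; apply: iJ; rewrite -E setU11.
case: QJ => i0J JD' Jh Jf Jm; exists J; split=> // i iD' iJ.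
apply/idPn => nd; apply: (Jmax i iJ).
have iD := subsetP D'D _ iD'.
have JD := subset_trans JD' D'D.
have iJD : i |: J \subset D by rewrite subUset sub1set iD.
have iJ0 : i |: J != set0 by apply/set0Pn; exists i; rewrite setU11.
have sumi : \sum_(j in i |: J) w j = w i + \sum_(j in J) w j by rewrite big_setU1.
have Wi : W (i |: J) = S i :|: W J by rewrite WU W1.
have cW : #|W (i |: J)| + #|S i :&: W J| = #|S i| + #|W J|.
  by rewrite Wi cardsU subnK // (leq_trans (subset_leq_card (subsetIl _ _))) // leq_addr.
have I0 : 0 < #|S i :&: W J| by rewrite card_gt0 setI_eq0.
have [[fi fi0] Sih] := (S_dense iD, S_dense i0D, S_small iD).
have cW' : #|W (i |: J)| <= #|S i| + #|W J| by rewrite -cW leq_addr.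
(* Two excesses of at most 5, less 5 per common point, leave at most 5, whereas [sparser] demands at
   least 9. *)
have Wh : #|W (i |: J)| < h.
  rewrite ltnNge; apply/negP => Wh.
  have W2h : h <= #|W (i |: J)| <= 2 * h.
    rewrite Wh /=; apply: leq_trans cW' _.
    by rewrite mul2n -addnn leq_add // ltnW.
  have := sparser iJD iJ0 W2h; rewrite sumi.
  move: cW I0 fi fi0 Jf; clear; lia.
have sp := sparse iJD iJ0 Wh; rewrite sumi in sp.
have mi := min_i0 i iD'.
have [spi spi0] := (sparse1 iD, sparse1 i0D).
(* A second common point would bring the excess of the union down to 0, against [sparse]. *)
have I1 : #|S i :&: W J| = 1.
  move: cW I0 fi fi0 Jf sp; clear; lia.
(* The excesses of [i] and [i0] add up to at least 6 and that of [i0] is not the larger. So at most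
   three cliques of [i] must be hit, and each keeps at least three points outside [r]. *)
have fi3 : 3 + w i <= 5 * #|S i|.
  move: cW I1 fi fi0 Jf sp mi spi spi0; clear; lia.
have /eqP/cards1P[r rE] := I1.
split; [by rewrite setU1r | by rewrite subUset sub1set iD' | by [] | by rewrite sumi; move: cW I1 fi fi0 Jf; clear; lia |].
have [|U Ui|M [Mdis Msub Mhit]] := @hitting_avoiding V 1 [set r] (Us i) isT.
- by have := Us_card iD; move: fi3; clear; lia.
- have /andP[_ /eqP U4] := Us_sub iD Ui; rewrite cardsD U4.
  by have := subset_leq_card (subsetIr U [set r]); rewrite cards1; clear; lia.
have MS e : e \in M -> exists2 U, U \in Us i & (e \subset U) && (e \subset S i :\ r).
  move=> /Msub[U Ui eU]; exists U => //; have /andP[US _] := Us_sub iD Ui.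
  by rewrite (subset_trans eU (subsetDl _ _)) (subset_trans eU) // setSD.
case: Jm => N [Ndis Nsub Nhit]; exists (M :|: N); split.
- apply: (disjoint_pairsU (A := S i :\ r) Mdis Ndis _ (match_sub Nsub)).
    by move=> e /MS[U _ /andP[]].
  rewrite -setI_eq0; apply/eqP/setP => x; rewrite !inE.
  apply/negP => /andP[/andP[xr xS] xW].
  have : x \in S i :&: W J by rewrite inE xS.
  by rewrite rE inE (negPf xr).
- move=> e /setUP[/MS[U Ui /andP[eU eS]]|/Nsub[j [jJ eS eU]]].
    exists i; rewrite setU11; split=> //; last by exists U.
    by apply: subset_trans eS (subsetDl _ _).
  by exists j; rewrite setU1r.
- move=> j U /setU1P[->|jJ] Uj.
    by have [e eM eU] := Mhit _ Uj; exists e; rewrite // inE eM.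
  by have [e eM eU] := Nhit _ _ jJ Uj; exists e; rewrite // inE eM orbT.
Qed.

(** Clusters are split off one after the other: if a union of clusters, untouched by the remaining
    components, is not everything, the remaining component of least excess starts a further
    cluster. *)
Lemma cluster_matching : exists M, [/\ disjoint_pairs M,
  forall e, e \in M -> exists i, [/\ i \in D, e \subset S i & exists2 U, U \in Us i & e \subset U]
  & forall i U, i \in D -> U \in Us i -> hits M U].
Proof.
pose P (H : {set I}) := [/\ H \subset D, matched H
  & forall i, i \in D -> i \notin H -> [disjoint S i & W H]].
have P0 : P set0.
  split; rewrite ?sub0set //; last first.
    by move=> i _ _; rewrite /W big_set0 -setI_eq0 setI0.
  by exists set0; split=> [|e|i U]; rewrite ?inE //; split=> e; rewrite inE.
have [H [HD Hm Hcl] Hmax] := exists_maximal P0.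
suff <- : H = D by [].
apply/eqP; rewrite eqEsubset HD -setD_eq0; apply/set0Pn => -[i1 i1DH].
have DHD : D :\: H \subset D := subsetDl _ _.
have [i0 i0DH imin] := arg_minnP (fun i => 5 * #|S i| - w i) i1DH.
have [J [i0J JDH Jm Jcl]] := cluster_of DHD i0DH imin.
have HJ : [disjoint W J & W H].
  rewrite -setI_eq0; apply/eqP/setP => x; rewrite !inE; apply/negP.
  move=> /andP[/bigcupP[i /(subsetP JDH)]]; rewrite inE => /andP[iH iD] xi xH.
  by have /disjointFr/(_ xi) := Hcl i iD iH; rewrite xH.
have PJ : P (J :|: H).
  split; first by rewrite subUset HD (subset_trans JDH DHD).
    exact: matchedU.
  move=> i iD; rewrite inE negb_or => /andP[iJ iH].
  rewrite WU -setI_eq0 setIUr setU_eq0 !setI_eq0 Hcl // andbT.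
  by apply: Jcl => //; rewrite inE iH.
have := Hmax _ PJ (subsetUr _ _) => E.
by have := subsetP JDH _ i0J; rewrite -E !inE i0J.
Qed.
End Cluster.

(** * Extending a colouring to a new vertex *)

Section Graph.
Variables (V : finType) (adj : rel V).
Hypothesis adj_sym : symmetric adj.
Hypothesis adj_irr : irreflexive adj.
Implicit Types (S T N : {set V}) (k : V -> V -> nat).

Definition nbr v S := [set x in S | adj v x].

(* Twice the number of edges inside [S]. *)
Definition e2 S := \sum_(x in S) #|nbr x S|.

Definition clique T := [forall x in T, forall y in T, (x != y) ==> adj x y].

Definition k4 T := (#|T| == 4) && clique T.

Definition colour_sym k := forall x y : V, k x y = k y x.

Definition proper_on k S := forall x y z, x \in S -> y \in S -> z \in S ->
  adj x y -> adj x z -> y != z -> k x y <> k x z.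

(* In a proper colouring, a colour repeated inside [T] sits on two disjoint edges. *)
Definition repeats k T := [exists a in T, exists b in T, exists c in T, exists d in T,
  uniq [:: a; b; c; d] && (k a b == k c d)].

Definition rainbow_k4s k S := [set T : {set V} | [&& T \subset S, k4 T & ~~ repeats k T]].

Definition cliques r N := [set t : {set V} | [&& t \subset N, #|t| == r & clique t]].

Definition sees k S a i := exists d, [/\ d \in S, adj a d & k a d = i].

Lemma cliqueP T : reflect {in T &, forall x y, x != y -> adj x y} (clique T).
Proof.
apply: (iffP forall_inP) => [H x y xT yT xy|H x xT].
  by have /forall_inP/(_ y yT)/implyP/(_ xy) := H x xT.
by apply/forall_inP => y yT; apply/implyP => xy; apply: H.
Qed.

Lemma clique_sub (A T : {set V}) : A \subset T -> clique T -> clique A.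
Proof. by move=> /subsetP AT /cliqueP H; apply/cliqueP => x y /AT xT /AT yT; apply: H. Qed.

Lemma repeatsP k T : reflect (exists a b c d, [/\ [/\ a \in T, b \in T, c \in T & d \in T],
  uniq [:: a; b; c; d] & k a b = k c d]) (repeats k T).
Proof.
apply: (iffP idP) => [/exists_inP[a aT /exists_inP[b bT /exists_inP[c cT /exists_inP[d dT]]]]|].
  by move=> /andP[u /eqP e]; exists a, b, c, d.
move=> [a [b [c [d [[aT bT cT dT] u e]]]]].
apply/exists_inP; exists a => //; apply/exists_inP; exists b => //.
by apply/exists_inP; exists c => //; apply/exists_inP; exists d; rewrite // u e eqxx.
Qed.

Lemma nbrU1 v x S : v \notin S -> x \in S -> #|nbr x (v |: S)| = #|nbr x S| + adj v x.
Proof.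
move=> vS xS; have [vx|vx] := boolP (adj v x).
  have -> : nbr x (v |: S) = v |: nbr x S.
    apply/setP => y; rewrite !inE; case: eqP => // ->.
    by rewrite adj_sym vx.
  by rewrite cardsU1 !inE (negPf vS) addnC.
rewrite addn0; apply: eq_card => y; rewrite !inE; case: eqP => // ->.
by rewrite adj_sym (negPf vx) !andbF.
Qed.

Lemma e2U1 v S : v \notin S -> e2 (v |: S) = e2 S + 2 * #|nbr v S|.
Proof.
move=> vS; rewrite /e2 big_setU1 //=.
have -> : nbr v (v |: S) = nbr v S.
  by apply/setP => y; rewrite !inE; case: eqP => // ->; rewrite adj_irr !andbF.
rewrite (eq_bigr (fun x => #|nbr x S| + adj v x)); last by move=> x xS; apply: nbrU1.
rewrite big_split /=.
have -> : \sum_(x in S) adj v x = #|nbr v S|.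
  rewrite -sum1_card big_mkcond [RHS]big_mkcond; apply: eq_bigr => x _.
  by rewrite inE; case: (x \in S); case: (adj v x).
by rewrite addnCA mul2n -addnn addnA.
Qed.

Section NewVertex.
Variables (v : V) (S : {set V}) (k : V -> V -> nat) (g : V -> nat).
Hypothesis vS : v \notin S.
Let N := nbr v S.
Hypothesis k_proper : proper_on k S.
Hypothesis g_inj : {in N &, injective g}.
Hypothesis g_ok : forall x, x \in N -> ~ sees k S x (g x).

Definition extend x y := if x == v then g y else if y == v then g x else k x y.

Lemma extend_sym : colour_sym k -> colour_sym extend.
Proof.
move=> k_sym x y; rewrite /extend.
by case: (x =P v) => [->|_]; case: (y =P v) => [e|_] //=; rewrite e.
Qed.

Lemma extend_old x y : x \in S -> y \in S -> extend x y = k x y.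
Proof.
move=> xS yS; rewrite /extend.
have [xv|_] := eqVneq x v; first by move: vS; rewrite -xv xS.
by have [yv|_] := eqVneq y v; first by move: vS; rewrite -yv yS.
Qed.

Lemma extend_newl x : extend v x = g x.
Proof. by rewrite /extend eqxx. Qed.

Lemma extend_newr x : extend x v = g x.
Proof. by rewrite /extend eqxx; case: eqP => // ->. Qed.

Lemma in_nbr x : x \in S -> adj v x -> x \in N.
Proof. by rewrite inE => -> ->. Qed.

Lemma extend_sees a i : a \in S -> sees extend (v |: S) a i ->
  sees k S a i \/ adj v a /\ i = g a.
Proof.
move=> aS [d [/setU1P[->|dS] ad <-]].
  by right; rewrite adj_sym ad extend_newr.
by left; exists d; rewrite extend_old.
Qed.

Lemma extend_sees_new i : sees extend (v |: S) v i -> exists2 x, x \in N & i = g x.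
Proof.
move=> [d [/setU1P[->|dS] ad <-]]; first by rewrite adj_irr in ad.
by exists d; rewrite ?extend_newl //; apply: in_nbr.
Qed.

Lemma extend_proper : proper_on extend (v |: S).
Proof.
move=> x y z /setU1P[->|xS] /setU1P[->|yS] /setU1P[->|zS]; rewrite ?adj_irr ?eqxx //.
- rewrite !extend_newl => vy vz yz /g_inj e; case/eqP: yz; apply: e; exact: in_nbr.
- rewrite extend_newr extend_old // adj_sym => vx xz _ e.
  by apply: (@g_ok x); [apply: in_nbr|exists z].
- rewrite extend_newr extend_old // => xy xv _ e.
  by apply: (@g_ok x); [apply: in_nbr; rewrite // adj_sym|exists y].
- by rewrite !extend_old //; apply: k_proper.
Qed.

Lemma repeats_extend T : T \subset S -> repeats extend T = repeats k T.
Proof.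
move=> /subsetP TS; apply/repeatsP/repeatsP => -[a [b [c [d [[aT bT cT dT] u]]]]].
  by rewrite !extend_old ?TS // => e; exists a, b, c, d.
by move=> e; exists a, b, c, d; split=> //; rewrite !extend_old ?TS.
Qed.

(** A 4-clique through [v] is [v] together with a triangle among its neighbours; every other one
    keeps its colours. *)
Lemma rainbow_extend : #|rainbow_k4s extend (v |: S)| <=
  #|rainbow_k4s k S| + #|[set t in cliques 3 N | ~~ repeats extend (v |: t)]|.
Proof.
set X := [set t in _ | _].
have vN : v \notin N by rewrite inE (negPf vS).
rewrite -[#|X|](card_in_imset (f := fun t => v |: t)); last first.
  move=> s t; rewrite !inE => /andP[/and3P[sN _ _] _] /andP[/and3P[tN _ _] _] st.
  have vs : v \notin s by apply: contra vN; apply: (subsetP sN).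
  have vt : v \notin t by apply: contra vN; apply: (subsetP tN).
  by rewrite -(setU1K vs) -(setU1K vt) st.
apply: leq_trans (leq_card_setU _ _); apply: subset_leq_card.
apply/subsetP => T; rewrite !inE => /and3P[TS T4 Tr].
have [vT|vT] := boolP (v \in T).
  apply/orP; right; apply/imsetP; exists (T :\ v); last by rewrite setD1K.
  rewrite !inE setD1K // Tr andbT; case/andP: T4 => /eqP T4 Tc.
  have -> : #|T :\ v| = 3 by have := cardsD1 v T; rewrite vT T4 add1n => -[].
  rewrite eqxx (clique_sub (subsetDl _ _) Tc) !andbT.
  apply/subsetP => x; rewrite !inE => /andP[xv xT].
  have /setU1P[/eqP|->] := subsetP TS _ xT; first by rewrite (negPf xv).
  by have /cliqueP := Tc; apply; rewrite // eq_sym.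
have TS' : T \subset S.
  apply/subsetP => x xT; have /setU1P[xv|//] := subsetP TS _ xT.
  by rewrite xv (negPf vT) in xT.
by rewrite TS' T4 -(repeats_extend TS') Tr.
Qed.
End NewVertex.

Definition fresh (K : nat) (x : V) := K + enum_rank x.

Lemma fresh_inj K : injective (fresh K).
Proof. by move=> x y /addnI/val_inj/enum_rank_inj. Qed.

Lemma colour_bound k : exists K, forall x y, k x y < K.
Proof.
exists (\max_x \max_y k x y).+1 => x y; rewrite ltnS.
by apply: leq_trans (leq_bigmax (F := fun x => \max_y k x y) x); apply: (leq_bigmax (F := k x)).
Qed.

End Graph.

(** * Triangles in small graphs without 4-cliques *)

(* Number of [r]-cliques of [a] inside [s] satisfying [p]. *)
Fixpoint clique_count (a : rel nat) r (p : pred nat) (s : seq nat) : nat :=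
  if r is r'.+1 then
    (fix loop p s := if s is x :: s' then
        loop p s' + (if p x then clique_count a r' (fun y => p y && a x y) s' else 0)
      else 0) p s
  else 1.

Lemma clique_count_cons a r p x s : clique_count a r.+1 p (x :: s) =
  clique_count a r.+1 p s + (if p x then clique_count a r (fun y => p y && a x y) s else 0).
Proof. by []. Qed.

Definition all_bits n := iter n (fun bs => [seq false :: b | b <- bs] ++ [seq true :: b | b <- bs]) [:: [::]].

Lemma mem_all_bits b : b \in all_bits (size b).
Proof.
elim: b => // x b IH; rewrite /all_bits /= mem_cat.
by case: x; rewrite map_f ?orbT.
Qed.

(* The pairs [i < j] are listed by increasing [j]; the table holds the numbers ['C(j, 2)]. *)
Definition bits_rel (b : seq bool) : rel nat := fun i j => nth false b (nth 0 [:: 0; 0; 1; 3; 6; 10] j + i).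

(* The octahedron, with 12 edges and 8 triangles, makes the bound on the edges necessary. *)
Definition few_triangles d (a : rel nat) :=
  (clique_count a 4 xpredT (iota 0 d) == 0) && (clique_count a 2 xpredT (iota 0 d) <= 11) ==>
  (clique_count a 3 xpredT (iota 0 d) <= 2 * d - 6).

Definition few_triangles_check d := all (fun b => few_triangles d (bits_rel b)) (all_bits 'C(d, 2)).

Lemma few_triangles_check4 : few_triangles_check 4. Proof. by vm_compute. Qed.
Lemma few_triangles_check5 : few_triangles_check 5. Proof. by vm_compute. Qed.
Lemma few_triangles_check6 : few_triangles_check 6. Proof. by vm_compute. Qed.

(** Only the values [a i j] with [i < j < d] enter the counts. Tabulating them as [b] reduces the
    claim to the exhaustive check, and both sides then agree by computation. *)
Lemma few_trianglesP d (a : rel nat) : 4 <= d <= 6 -> few_triangles d a.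
Proof.
move=> d46.
pose b := flatten [seq [seq a i j | i <- iota 0 j] | j <- iota 0 d].
have check : few_triangles_check d.
  case: d d46 {b} => [|[|[|[|[|[|[|d]]]]]]] d46; [by case/andP: d46 ..| | | |by case/andP: d46].
  - exact: few_triangles_check4.
  - exact: few_triangles_check5.
  - exact: few_triangles_check6.
have sb : size b = 'C(d, 2).
  rewrite /b; case: d d46 {b check} => [|[|[|[|[|[|[|d]]]]]]] d46; by [|case/andP: d46].
have : few_triangles d (bits_rel b).
  by apply: (allP check); rewrite -sb; apply: mem_all_bits.
clear check sb; rewrite {}/b; case: d d46 => [|[|[|[|[|[|[|d]]]]]]] d46;
 [by case/andP: d46 ..| | | |by case/andP: d46]; exact.
Qed.

Section Counting.
Variables (V : finType) (adj : rel V).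
Hypothesis adj_sym : symmetric adj.
Hypothesis adj_irr : irreflexive adj.
Implicit Types (A N : {set V}).
Local Notation cliques := (cliques adj).
Local Notation nbr := (nbr adj).

Lemma cliquesU1 r x A : x \notin A ->
  #|cliques r.+1 (x |: A)| = #|cliques r.+1 A| + #|cliques r (nbr x A)|.
Proof.
move=> xA; have xt t : t \in cliques r (nbr x A) -> x \notin t.
  rewrite inE => /and3P[/subsetP tN _ _]; apply/negP => /tN.
  by rewrite inE (negPf xA).
rewrite -(card_in_imset (D := mem (cliques r (nbr x A))) (f := fun t => x |: t)); last first.
  by move=> s t sC tC st; rewrite -(setU1K (xt s sC)) -(setU1K (xt t tC)) st.
rewrite -[LHS]addn0 -(cards0 {set V}).
have -> : set0 = cliques r.+1 A :&: [set x |: t | t in cliques r (nbr x A)].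
  apply/esym/eqP; rewrite setI_eq0; apply/pred0P => t /=.
  apply/negP => /andP[]; rewrite inE => /and3P[/subsetP tA _ _] /imsetP[s _ ts].
  by move: xA; rewrite tA // ts setU11.
rewrite -cardsUI; congr (_ + _); apply: eq_card => t; rewrite !inE.
apply/idP/idP => [/and3P[tA tr tc]|/orP[/and3P[tA tr tc]|/imsetP[s]]].
- have [xint|xnt] := boolP (x \in t); last first.
    rewrite tr tc !andbT; apply/orP; left; apply/subsetP => y yt.
    by have /setU1P[yx|//] := subsetP tA _ yt; rewrite yx (negPf xnt) in yt.
  apply/orP; right; apply/imsetP; exists (t :\ x); last by rewrite setD1K.
  rewrite inE (clique_sub (subsetDl _ _) tc) andbT.
  have -> : #|t :\ x| == r by move: tr; rewrite (cardsD1 x t) xint add1n eqSS.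
  rewrite andbT; apply/subsetP => y; rewrite !inE => /andP[yx yt].
  have /setU1P[/eqP|->] := subsetP tA _ yt; first by rewrite (negPf yx).
  by have /cliqueP := tc; apply; rewrite // eq_sym.
- by rewrite tr tc (subset_trans tA) ?subsetUr.
- move=> sC ->; have xs := xt s sC; move: sC; rewrite inE => /and3P[/subsetP sN sr sc].
  rewrite cardsU1 xs add1n eqSS sr setUS /=; last first.
    by apply/subsetP => y /sN; rewrite inE => /andP[].
  apply/cliqueP => y z /setU1P[->|ys] /setU1P[->|zs]; rewrite ?eqxx // => yz.
  + by have := sN _ zs; rewrite inE => /andP[].
  + by have := sN _ ys; rewrite inE adj_sym => /andP[].
  + by have /cliqueP := sc; apply.
Qed.

Lemma cliques0 A : #|cliques 0 A| = 1.
Proof.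
rewrite (_ : cliques 0 A = [set set0]) ?cards1 //; apply/setP => t; rewrite !inE cards_eq0.
case: eqP => [->|]; last by rewrite andbF.
by rewrite sub0set; apply/cliqueP => x y; rewrite inE.
Qed.

Lemma cliquesS0 r : #|cliques r.+1 set0| = 0.
Proof.
apply/eqP; rewrite cards_eq0; apply/eqP/setP => t; rewrite !inE subset0.
by case: eqP => [->|//]; rewrite cards0.
Qed.

Lemma cliques1 A : #|cliques 1 A| = #|A|.
Proof.
have [n] := ubnP #|A|; elim: n A => // n IH A.
have [->|[x xA]] := set_0Vmem A; first by rewrite cliquesS0 cards0.
rewrite -(setD1K xA) cliquesU1 ?inE ?eqxx // cliques0 cardsU1 !inE eqxx /= add1n ltnS addn1.
by move=> lt; rewrite IH.
Qed.

Lemma e2_cliques A : e2 adj A = 2 * #|cliques 2 A|.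
Proof.
have [n] := ubnP #|A|; elim: n A => // n IH A.
have [->|[x xA]] := set_0Vmem A; first by rewrite cliquesS0 /e2 big_set0.
rewrite -(setD1K xA) e2U1 ?cliquesU1 ?inE ?eqxx // cliques1 mulnDr cardsU1 !inE eqxx ltnS.
by move=> lt; rewrite IH.
Qed.

Lemma cliques_count (f : nat -> V) r p s : uniq (map f s) ->
  #|cliques r [set y in [seq f i | i <- s & p i]]| = clique_count (fun i j => adj (f i) (f j)) r p s.
Proof.
elim: r p s => [|r IHr] p s; first by rewrite cliques0.
elim: s p => [|x s IHs] p; first by rewrite -[RHS](cliquesS0 r) //; congr #|cliques _ _|; apply/setP => y; rewrite !inE.
rewrite map_cons cons_uniq clique_count_cons => /andP[xs us].
have -> : [seq i <- x :: s | p i] = if p x then x :: [seq i <- s | p i] else [seq i <- s | p i] by [].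
case: ifP => _; last by rewrite IHs // addn0.
rewrite map_cons -(IHs p us) -IHr //.
rewrite (_ : [set y in _ :: _] = f x |: [set y in [seq f i | i <- s & p i]]); last first.
  by apply/setP => y; rewrite !inE.
rewrite cliquesU1; last first.
  rewrite inE; apply: contra xs => /mapP[i]; rewrite mem_filter => /andP[_ is_] ->.
  exact: map_f.
congr (_ + #|cliques r _|); apply/setP => y; rewrite !inE.
apply/andP/mapP => [[/mapP[i]]|[i]]; rewrite mem_filter => /andP[].
  by move=> pi is_ -> ad; exists i; rewrite // mem_filter pi ad.
move=> /andP[pi ad] is_ ->; split=> //.
by apply/mapP; exists i; rewrite // mem_filter pi.
Qed.

(** Enumerating [N] transports its graph to [iota 0 #|N|]; the bound 22 on [e2] is the bound 11 on
    the number of edges. *)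
Lemma card_triangles_le N : 4 <= #|N| <= 6 -> cliques 4 N = set0 -> e2 adj N <= 22 ->
  #|cliques 3 N| <= 2 * #|N| - 6.
Proof.
move=> N46 N4; rewrite e2_cliques => N2.
have /card_gt0P[x0 _] : 0 < #|N| by move: N46; clear; lia.
pose f i := nth x0 (enum N) i.
have mapf : map f (iota 0 #|N|) = enum N.
  by rewrite cardE map_nth_iota0 // take_size.
have Nf : N = [set y in [seq f i | i <- iota 0 #|N| & xpredT i]].
  by apply/setP => y; rewrite filter_predT mapf inE mem_enum.
have uf : uniq (map f (iota 0 #|N|)) by rewrite mapf enum_uniq.
have C r : #|cliques r N| = clique_count (fun i j => adj (f i) (f j)) r xpredT (iota 0 #|N|).
  by rewrite {1}Nf cliques_count.
have := few_trianglesP (fun i j => adj (f i) (f j)) N46; rewrite /few_triangles -!C N4 cards0 eqxx.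
by move/implyP; apply; move: N2; clear; lia.
Qed.
End Counting.

(** * Colouring one component *)

Section Colouring.
Variables (V : finType) (adj : rel V).
Hypothesis adj_sym : symmetric adj.
Hypothesis adj_irr : irreflexive adj.
Implicit Types (S T N : {set V}) (k : V -> V -> nat).
Local Notation cliques := (cliques adj).
Local Notation nbr := (nbr adj).
Local Notation sees := (sees adj).
Local Notation proper_on := (proper_on adj).
Local Notation rainbow_k4s := (rainbow_k4s adj).

Lemma adj_neq x y : adj x y -> x != y.
Proof. by apply: contraTneq => ->; rewrite adj_irr. Qed.

(* A new vertex [v] joined to a triangle [x y z] can repeat the colour of [yz] on [vx] unless
   [x] already sees this colour. *)
Definition bad k S x y z := sees k S x (k y z).

Definition triangle S x y z :=
  [/\ x \in S, y \in S & z \in S] /\ [/\ adj x y, adj x z & adj y z].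

Lemma triangle_swap S x y z : triangle S x y z -> triangle S x z y.
Proof. by move=> [[xS yS zS] [xy xz yz]]; split; split; rewrite // adj_sym. Qed.

Lemma triangle_rot S x y z : triangle S x y z -> triangle S y z x.
Proof. by move=> [[xS yS zS] [xy xz yz]]; split; split; rewrite // adj_sym. Qed.

Definition no_two_bad k S := forall x y z, triangle S x y z ->
  bad k S x y z -> bad k S y x z -> False.

(** This is what sparing one 4-clique at a new vertex requires; [no_two_bad] is a reserve that still
    guarantees it after one more vertex. *)
Definition no_three_bad k S := forall x y z, triangle S x y z ->
  bad k S x y z -> bad k S y x z -> bad k S z x y -> False.

Lemma no_two_three k S : no_two_bad k S -> no_three_bad k S.
Proof. by move=> H x y z t bx b_y _; apply: H t bx b_y. Qed.

Section Special.
Variables (v : V) (S : {set V}) (k : V -> V -> nat) (K : nat) (o : option V) (j : nat).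
Hypothesis vS : v \notin S.
Hypothesis k_sym : colour_sym k.
Hypothesis k_proper : proper_on k S.
Hypothesis k_lt : forall x y, k x y < K.
Hypothesis j_lt : j < K.
Hypothesis o_ok : forall x, o = Some x -> ~ sees k S x j.

Definition special x := if o == Some x then j else fresh K x.

Lemma special_inj : injective special.
Proof.
have frK (x : V) : fresh K x <> j by rewrite /fresh; move: j_lt; clear; lia.
move=> x y; rewrite /special; case: eqP => [ox|_]; case: eqP => [oy|_].
- by move: ox; rewrite oy => -[].
- by move=> e; case: (@frK y).
- by move=> e; case: (@frK x).
- exact: fresh_inj.
Qed.

Lemma sees_lt a i : sees k S a i -> i < K.
Proof. by move=> [d [_ _ <-]]. Qed.

Lemma not_fresh (x : V) i : i < K -> fresh K x <> i.
Proof. rewrite /fresh; clear; lia. Qed.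

Lemma special_ok x : x \in nbr v S -> ~ sees k S x (special x).
Proof.
move=> _; rewrite /special; case: eqP => [/o_ok //|_] /sees_lt.
by move/(@not_fresh x).
Qed.

Let k' := extend v k special.

Lemma special_proper : proper_on k' (v |: S).
Proof. exact: (extend_proper adj_sym adj_irr vS k_proper (in2W special_inj) special_ok). Qed.

Lemma bad_old a b c : a \in S -> b \in S -> c \in S -> bad k' (v |: S) a b c ->
  bad k S a b c \/ o = Some a /\ k b c = j.
Proof.
move=> aS bS cS; rewrite /bad /k' (extend_old _ _ vS bS cS) => /(extend_sees adj_sym vS aS)[|[_]]; first by left.
by rewrite /special; case: eqP => [oa|_ /esym/not_fresh []]; [right|].
Qed.

Lemma bad_apex b c : b \in S -> c \in S -> bad k' (v |: S) v b c -> o <> None /\ k b c = j.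
Proof.
move=> bS cS; rewrite /bad /k' (extend_old _ _ vS bS cS) => /(extend_sees_new adj_irr)[x _].
by rewrite /special; case: eqP => [-> //|_ /esym/not_fresh []].
Qed.

Lemma bad_base a b : a \in S -> a != b -> bad k' (v |: S) a v b -> o = Some b.
Proof.
move=> aS ab; rewrite /bad /k' extend_newl => /(extend_sees adj_sym vS aS)[/sees_lt|[_ /special_inj e]].
  by rewrite /special; case: eqP => // _; rewrite /fresh => lt; exfalso; move: lt; clear; lia.
by rewrite e eqxx in ab.
Qed.

Lemma bad_sym a b c : bad k' (v |: S) a b c -> bad k' (v |: S) a c b.
Proof. by rewrite /bad /k' (extend_sym _ _ k_sym b c). Qed.

(** An old triangle had at most one bad vertex, and only the vertex selected by [o] can become bad.
    In a triangle at [v], if both base vertices were bad, [o] would select two vertices. *)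
Lemma special_no_three : no_two_bad k S -> no_three_bad k' (v |: S).
Proof.
move=> H; have v3 b c : b \in S -> c \in S -> b != c ->
    bad k' (v |: S) b v c -> bad k' (v |: S) c v b -> False.
  move=> bS cS bc /(bad_base bS bc) ob; rewrite eq_sym in bc.
  by move=> /(bad_base cS bc); rewrite ob => -[e]; rewrite e eqxx in bc.
move=> x y z t; case: (t) => -[xS yS zS] [xy xz yz].
have neq a b : adj a b -> o = Some a -> o = Some b -> False.
  by move=> ab -> [e]; rewrite e adj_irr in ab.
move: xS yS zS => /setU1P[xv|xS] /setU1P[yv|yS] /setU1P[zv|zS];
  rewrite ?xv ?yv ?zv ?adj_irr // in xy xz yz *.
- by move=> _ b1 b2; apply: (v3 y z) => //; apply: adj_neq.
- by move=> b1 _ /bad_sym b2; apply: (v3 x z) => //; apply: adj_neq.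
- by move=> /bad_sym b1 /bad_sym b2 _; apply: (v3 x y) => //; apply: adj_neq.
have tS : triangle S x y z by [].
have tS' := triangle_swap tS; have tS'' := triangle_rot tS.
have ksw a b c : bad k S a b c -> bad k S a c b by rewrite /bad k_sym.
move=> /(bad_old xS yS zS)[bx|[ox _]] /(bad_old yS xS zS)[b_y|[oy _]] /(bad_old zS xS yS)[bz|[oz _]].
- exact: (H _ _ _ tS).
- exact: (H _ _ _ tS).
- by apply: (H _ _ _ tS' (ksw _ _ _ bx) bz).
- exact: (neq y z).
- by apply: (H _ _ _ tS'' (ksw _ _ _ b_y) (ksw _ _ _ bz)).
- exact: (neq x z).
- exact: (neq x y).
- exact: (neq x y).
Qed.

End Special.

Lemma triangle_pick N t : t \in cliques 3 N -> exists x y z,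
  [/\ x \in t, y \in t & z \in t] /\ [/\ adj x y, adj x z & adj y z].
Proof.
rewrite inE => /and3P[_ /eqP t3 /cliqueP tc].
have /card_gt2P[x [y [z [[xt yt zt] [xy yz zx]]]]] : 2 < #|t| by rewrite t3.
by exists x, y, z; split; split=> //; apply: tc; rewrite // eq_sym.
Qed.

Lemma cliques_sub r N t : t \in cliques r N -> t \subset N.
Proof. by rewrite inE => /and3P[]. Qed.

Lemma extend_fresh v S k : v \notin S -> colour_sym k -> proper_on k S ->
  exists k', [/\ colour_sym k', proper_on k' (v |: S),
    #|rainbow_k4s k' (v |: S)| <= #|rainbow_k4s k S| + #|cliques 3 (nbr v S)|
    & no_two_bad k S -> no_three_bad k' (v |: S)].
Proof.
move=> vS ks kp; have [K kK] := colour_bound k.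
exists (extend v k (special K None 0)).
have K0 : 0 < K by apply: leq_trans (kK v v).
have oN (x : V) : None = Some x -> ~ sees k S x 0 by [].
split; first exact: extend_sym.
- exact: special_proper.
- apply: leq_trans (rainbow_extend _ _ _ vS) _; rewrite leq_add2l.
  by apply: subset_leq_card; apply/subsetP => t; rewrite !inE => /andP[].
- exact: special_no_three.
Qed.

(** Some triangle [x y z] of neighbours, if there is any, has a vertex [x] that is not bad. Giving
    [vx] the colour of [yz] spoils the 4-clique on [v] and this triangle. *)
Lemma extend_paired v S k : v \notin S -> colour_sym k -> proper_on k S -> no_three_bad k S ->
  exists k', [/\ colour_sym k', proper_on k' (v |: S),
    #|rainbow_k4s k' (v |: S)| <= #|rainbow_k4s k S| + #|cliques 3 (nbr v S)|.-1
    & no_two_bad k S -> no_three_bad k' (v |: S)].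
Proof.
move=> vS ks kp n3; have [t0|[t tC]] := set_0Vmem (cliques 3 (nbr v S)).
  by have := extend_fresh vS ks kp; rewrite t0 cards0.
have [x [y [z [[xt yt zt] [xy xz yz nbx]]]]] : exists x y z,
    [/\ x \in t, y \in t & z \in t] /\ [/\ adj x y, adj x z, adj y z & ~ bad k S x y z].
  have [x [y [z [[xt yt zt] [xy xz yz]]]]] := triangle_pick tC.
  have tS a : a \in t -> a \in S by move/(subsetP (cliques_sub tC)); rewrite inE => /andP[].
  have T : triangle S x y z by split; split=> //; apply: tS.
  have [bx|nb] := EM (bad k S x y z); last by exists x, y, z.
  have [b_y|nb] := EM (bad k S y x z); last by exists y, x, z; rewrite adj_sym.
  have [bz|nb] := EM (bad k S z x y); first by case: (n3 _ _ _ T).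
  by exists z, x, y; rewrite ![adj z _]adj_sym.
have [K kK] := colour_bound k.
have ok a : Some x = Some a -> ~ sees k S a (k y z) by move=> [<-].
exists (extend v k (special K (Some x) (k y z))).
split; first exact: extend_sym.
- exact: special_proper.
- apply: leq_trans (rainbow_extend _ _ _ vS) _; rewrite leq_add2l.
  rewrite (cardsD1 t (cliques 3 _)) tC /=.
  apply: subset_leq_card; apply/subsetP => s; rewrite in_setD1 in_set => /andP[-> nr].
  rewrite andbT; apply: contra nr => /eqP->.
  have vt a : a \in t -> v != a.
    move/(subsetP (cliques_sub tC)); rewrite inE => /andP[aS _].
    by apply: contraNneq vS => ->.
  have tS a : a \in t -> a \in S by move/(subsetP (cliques_sub tC)); rewrite inE => /andP[].
  apply/repeatsP; exists v, x, y, z; split.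
  + by split; rewrite ?setU11 // setU1r.
  + by rewrite /= !inE !negb_or !vt // !adj_neq.
  + by rewrite extend_newl (extend_old _ _ vS) ?tS // /special eqxx.
- exact: special_no_three.
Qed.

End Colouring.

(** * Adding two adjacent vertices over a common edge *)

Section PairStep.
Variables (V : finType) (adj : rel V).
Hypothesis adj_sym : symmetric adj.
Hypothesis adj_irr : irreflexive adj.
Implicit Types (S T N : {set V}) (k : V -> V -> nat).
Local Notation cliques := (cliques adj).
Local Notation nbr := (nbr adj).
Local Notation sees := (sees adj).
Local Notation proper_on := (proper_on adj).
Local Notation rainbow_k4s := (rainbow_k4s adj).

Lemma cliques_small r N : #|N| < r -> cliques r N = set0.
Proof.
move=> lt; apply/setP => t; rewrite !inE; apply/negP => /and3P[/subset_leq_card le /eqP tr _].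
by move: lt; rewrite -tr ltnNge le.
Qed.

Lemma extend_pair u v x y S k : u != v -> u \notin S -> v \notin S -> adj u v -> adj x y ->
  nbr u S = [set x; y] -> nbr v S = [set x; y] -> colour_sym k -> proper_on k S ->
  exists k', [/\ colour_sym k', proper_on k' (u |: (v |: S)),
    #|rainbow_k4s k' (u |: (v |: S))| <= #|rainbow_k4s k S|,
    no_two_bad adj k S -> no_two_bad adj k' (u |: (v |: S))
    & no_three_bad adj k S -> no_three_bad adj k' (u |: (v |: S))].
Proof.
move=> uv uS vS auv axy Nu Nv ks kp.
have xy := adj_neq adj_irr axy.
have [K kK] := colour_bound k.
have K0 : 0 < K by apply: leq_trans (kK v v).
have oN (a : V) : None = Some a -> ~ sees k S a 0 by [].
pose k1 := extend v k (special K None 0); set S1 := v |: S.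
have k1s : colour_sym k1 by exact: extend_sym.
have k1p : proper_on k1 S1 by exact: special_proper.
have uS1 : u \notin S1 by rewrite !inE negb_or uv.
have Nu1 : nbr u S1 = v |: [set x; y].
  rewrite -Nu; apply/setP => a; rewrite !inE; case: eqP => // ->.
  by rewrite auv.
have xN : x \in nbr v S by rewrite Nv !inE eqxx.
have yN : y \in nbr v S by rewrite Nv !inE eqxx orbT.
have [xS avx] : x \in S /\ adj v x by apply/andP; move: xN; rewrite inE.
have [yS avy] : y \in S /\ adj v y by apply/andP; move: yN; rewrite inE.
have [xS1 yS1 vS1] : [/\ x \in S1, y \in S1 & v \in S1] by rewrite !inE xS yS eqxx !orbT.
have k1v a : k1 v a = fresh K a by rewrite /k1 extend_newl.
have [K1 kK1] := colour_bound k1.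
have okx a : Some x = Some a -> ~ sees k1 S1 a (k1 v y).
  by move=> [<-] /(bad_base adj_sym vS kK K0 xS xy).
exists (extend u k1 (special K1 (Some x) (k1 v y))); set k2 := extend u _ _.
have k2s : colour_sym k2 by exact: extend_sym.
(* No triangle through [u] or [v] has two bad vertices. *)
have two a b c : triangle adj (u |: S1) a b c ->
    bad adj k2 (u |: S1) a b c -> bad adj k2 (u |: S1) b a c ->
    [/\ triangle adj S a b c, bad adj k S a b c & bad adj k S b a c].
  have inN d : d \in S1 -> adj u d -> [\/ d = v, d = x | d = y].
    move=> dS aud; have : d \in nbr u S1 by rewrite inE dS.
    rewrite Nu1 !inE => /or3P[]/eqP->; by [constructor 1|constructor 2|constructor 3].
  (* Here [e] must be [x] and [de] must have the colour of [vy]. As [d] is [v] or [y], this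
     contradicts properness at [d]. *)
  have apex d e : d \in S1 -> e \in S1 -> adj d e -> adj u d -> d != e ->
      bad adj k2 (u |: S1) u d e -> bad adj k2 (u |: S1) d u e -> False.
    move=> dS eS ade aud de /(bad_apex adj_irr uS1 kK1 dS eS)[_ kde].
    move=> /(bad_base adj_sym uS1 kK1 (kK1 _ _) dS de)[ex]; subst e.
    have [dv|dx|dy] := inN d dS aud.
    - subst d; apply: (k1p v x y) => //.
    - by rewrite dx eqxx in de.
    - subst d; apply: (k1p y x v) => //; rewrite 1?adj_sym //; first by apply: contraNneq vS => <-.
      by rewrite kde k1s.
  move=> T; case: (T) => -[aS bS cS] [ab ac bc].
  have [nab nac nbc] : [/\ a != b, a != c & b != c] by split; apply: (adj_neq adj_irr).
  move: aS bS cS => /setU1P[au|aS] /setU1P[bu|bS] /setU1P[cu|cS];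
    try (by move: ab ac bc; rewrite ?au ?bu ?cu !adj_irr).
  - by subst a => b1 b2; case: (apex b c).
  - subst b => b1 b2; case: (apex a c) => //; by rewrite adj_sym.
  - subst c => /(bad_sym k1s) /(bad_base adj_sym uS1 kK1 (kK1 _ _) aS nab)[e].
    rewrite eq_sym in nab.
    move=> /(bad_sym k1s) /(bad_base adj_sym uS1 kK1 (kK1 _ _) bS nab)[e'].
    by move: nab; rewrite -e -e' eqxx.
  (* The colour of [vy] is at least [K], so no edge inside [S] carries it. *)
  have edge d e : d \in S1 -> e \in S1 -> k1 d e = k1 v y -> (d == v) || (e == v).
    move=> dS eS; rewrite k1v; apply: contraPT; rewrite negb_or => /andP[dv ev].
    have [dS' eS'] : d \in S /\ e \in S.
      by move: dS eS; rewrite !inE (negPf dv) (negPf ev).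
    by rewrite /k1 (extend_old _ _ vS dS' eS') => kde; have := kK d e; rewrite kde ltnNge leq_addr.
  have old1 d e f : d \in S1 -> e \in S1 -> f \in S1 -> d != e -> d != f -> e != f ->
      bad adj k1 S1 d e f -> [/\ d \in S, e \in S & f \in S] /\ bad adj k S d e f.
    move=> dS eS fS de df ef b1; have [dv|dv] := eqVneq d v.
      have [eS' fS'] : e \in S /\ f \in S.
        by split; [move: eS|move: fS] => /setU1P[ev|//]; [move: de|move: df]; rewrite ev dv eqxx.
      by move: b1; rewrite dv => /(bad_apex adj_irr vS kK eS' fS')[].
    have dS' : d \in S by move: dS; rewrite inE in_set1 (negPf dv).
    move: eS fS b1 => /setU1P[ev|eS'] /setU1P[fv|fS']; rewrite ?ev ?fv.
    - by move: ef; rewrite ev fv eqxx.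
    - by move=> /(bad_base adj_sym vS kK K0 dS' df).
    - by move=> /(bad_sym ks) /(bad_base adj_sym vS kK K0 dS' de).
    - by move=> /(bad_old adj_sym vS kK dS' eS' fS')[|[]].
  have nba : b != a by rewrite eq_sym.
  have vnot d e : d \in S -> e \in S -> (d == v) || (e == v) -> False.
    by move=> dS eS /orP[] /eqP E; move: vS; rewrite -E ?dS ?eS.
  move=> /(bad_old adj_sym uS1 kK1 aS bS cS)[b1|[[xa] kbc]];
    move=> /(bad_old adj_sym uS1 kK1 bS aS cS)[b2|[[xb] kac]].
  - have [[aS' bS' cS'] b1'] := old1 _ _ _ aS bS cS nab nac nbc b1.
    by have [_ b2'] := old1 _ _ _ bS aS cS nba nbc nac b2.
  - have [[aS' bS' cS'] _] := old1 _ _ _ aS bS cS nab nac nbc b1.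
    by case: (vnot a c aS' cS' (edge _ _ aS cS kac)).
  - have [[bS' aS' cS'] _] := old1 _ _ _ bS aS cS nba nbc nac b2.
    by case: (vnot b c bS' cS' (edge _ _ bS cS kbc)).
  - by move: nab; rewrite -xa -xb eqxx.
split.
- exact: k2s.
- exact: special_proper.
- apply: leq_trans (rainbow_extend _ _ _ uS1) _.
  apply: leq_trans (_ : #|rainbow_k4s k S| + 0 + 0 <= _); last by rewrite !addn0.
  apply: leq_add.
    apply: leq_trans (rainbow_extend _ _ _ vS) _; rewrite leq_add2l.
    rewrite (_ : cliques 3 _ = set0); last by rewrite cliques_small // Nv cards2 xy.
    by rewrite leqn0 cards_eq0; apply/eqP/setP => t; rewrite !inE.
  rewrite leqn0 cards_eq0; apply/eqP/setP => t; rewrite !inE; apply/negbTE/negP.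
  move=> /andP[/and3P[tN /eqP t3 _]]; rewrite -/S1 Nu1 in tN *.
  have tE : t = v |: [set x; y].
    apply/eqP; rewrite eqEcard tN t3 cardsU1 cards2 xy.
    by case: (v \notin _).
  apply/negP; rewrite negbK tE; apply/repeatsP; exists u, x, v, y; split.
  + by split; rewrite !inE !eqxx ?orbT.
  + rewrite /= !inE !negb_or uv xy andbT.
    have [ux uy vx vy] : [/\ u != x, u != y, v != x & v != y].
      by split; apply/eqP => E; [move: uS|move: uS|move: vS|move: vS]; rewrite E ?xS ?yS.
    by rewrite ux uy vy eq_sym vx.
  + by rewrite extend_newl (extend_old _ _ uS1) // /special eqxx.
- by move=> n2 a b c T b1 b2; have [T' b1' b2'] := two a b c T b1 b2; apply: n2 T' b1' b2'.
- move=> n3 a b c T b1 b2 b3; have [T' b1' b2'] := two a b c T b1 b2.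
  have T2 := triangle_rot adj_sym (triangle_rot adj_sym T).
  have [_ b3' _] := two c a b T2 b3 (bad_sym k1s b1).
  exact: n3 T' b1' b2' b3'.
Qed.
End PairStep.

(** * Growing a component together with its colouring *)

Section Component.
Variables (V : finType) (adj : rel V).
Hypothesis adj_sym : symmetric adj.
Hypothesis adj_irr : irreflexive adj.
Implicit Types (S T N : {set V}) (k : V -> V -> nat).
Local Notation cliques := (cliques adj).
Local Notation nbr := (nbr adj).
Local Notation proper_on := (proper_on adj).
Local Notation rainbow_k4s := (rainbow_k4s adj).
Local Notation e2 := (e2 adj).
Variable h : nat.
Hypothesis h8 : 8 <= h.
Hypothesis sparse : forall S, 0 < #|S| < h -> e2 S < 5 * #|S|.
Hypothesis sparser : forall S, h <= #|S| <= 2 * h -> e2 S + 8 < 5 * #|S|.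
Hypothesis connected : forall S, (exists x y, [/\ x \in S, y \in S & adj x y]) ->
  (forall T, k4 adj T -> 1 < #|T :&: S| -> T \subset S) -> forall x y, adj x y -> x \in S.

Definition excess S := 5 * #|S| - e2 S.

(** A maximal set with excess at most 8 and property [P] contains every 4-clique that shares two
    vertices with it, so by [connected] it covers all edges. The colouring invariant [P] is left
    open to serve both with and without a 5-clique. *)
Lemma grow (P : {set V} -> Prop) (A : {set V}) x0 y0 : x0 \in A -> y0 \in A -> adj x0 y0 ->
  #|A| < h -> 5 * #|A| <= e2 A + 8 -> P A ->
  (forall S v, A \subset S -> 5 * #|S| <= e2 S + 8 -> P S -> v \notin S -> 3 <= #|nbr v S| ->
     #|v |: S| < h -> P (v |: S)) ->
  (forall S u v x y, u != v -> u \notin S -> v \notin S -> adj u v -> adj x y ->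
     nbr u S = [set x; y] -> nbr v S = [set x; y] -> e2 (u |: (v |: S)) = e2 S + 10 ->
     #|u |: (v |: S)| = #|S| + 2 -> P S -> P (u |: (v |: S))) ->
  exists S, [/\ forall x y, adj x y -> x \in S, #|S| < h, 5 * #|S| <= e2 S + 8 & P S].
Proof.
move=> x0A y0A a0 Ah Af PA Pv Puv.
pose Q S := [/\ A \subset S, #|S| < h, 5 * #|S| <= e2 S + 8 & P S].
have QA : Q A by split.
have [S [AS Sh Sf PS] Smax] := exists_maximal QA.
exists S; split=> //; apply: connected.
  by exists x0, y0; split=> //; apply: (subsetP AS).
move=> T /andP[/eqP T4 Tc] TS; apply/subsetPn => -[v0 v0T v0S].
have {}Tc := cliqueP _ _ Tc.
have step S' : Q S' -> S \subset S' -> S' = S by apply: Smax.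
(* Three neighbours would allow adding [v]: the excess drops, and staying at most 8 it forbids [h]
   or more vertices by [sparser]. *)
have noV v : v \notin S -> #|nbr v S| <= 2.
  move=> vS; rewrite leqNgt; apply/negP => N3.
  have cv : #|v |: S| = #|S|.+1 by rewrite cardsU1 vS.
  have ev := e2U1 adj_sym adj_irr vS.
  have vh : #|v |: S| < h.
    rewrite ltnNge; apply/negP => le.
    have W : h <= #|v |: S| <= 2 * h by rewrite le cv; move: Sh h8; clear; lia.
    by have := sparser W; rewrite cv ev; move: Sf N3; clear; lia.
  have Qv : Q (v |: S).
    split=> //; first by apply: subset_trans AS (subsetUr _ _).
    + by rewrite cv ev; move: Sf N3; clear; lia.
    + exact: Pv.
  by move: vS; rewrite -(step _ Qv (subsetUr _ _)) setU11.
have TSN v : v \in T -> v \notin S -> T :&: S \subset nbr v S.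
  move=> vT vS; apply/subsetP => w; rewrite !inE => /andP[wT wS]; rewrite wS.
  by apply: Tc => //; apply: contraNneq vS => ->.
have N2 v : v \in T -> v \notin S -> nbr v S = T :&: S.
  move=> vT vS; apply/esym/eqP; rewrite eqEcard TSN //.
  by apply: leq_trans (noV v vS) TS.
have TS2 : #|T :&: S| = 2.
  by apply/eqP; rewrite eqn_leq TS andbT -(N2 _ v0T v0S) noV.
have /card_gt1P[u [v [uD vD uv]]] : 1 < #|T :\: S| by rewrite cardsD T4 TS2.
move: uD vD; rewrite !inE => /andP[uS uT] /andP[vS vT].
have [x [y xy TSxy]] : exists x, exists2 y, x != y & T :&: S = [set x; y].
  by have /eqP/cards2P[x [y [xy e]]] := TS2; exists x, y.
have auv : adj u v by apply: Tc.
have uS' : u \notin v |: S by rewrite !inE negb_or uv.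
have axy : adj x y.
  have xT : x \in T :&: S by rewrite TSxy !inE eqxx.
  have yT : y \in T :&: S by rewrite TSxy !inE eqxx orbT.
  by apply: Tc => //; [move: xT|move: yT]; rewrite inE => /andP[].
have Nu' : #|nbr u (v |: S)| = 3.
  rewrite (_ : nbr u _ = v |: nbr u S); first by rewrite cardsU1 N2 // TS2 !inE (negPf vS) andbF.
  by apply/setP => a; rewrite !inE; case: eqP => // ->; rewrite auv.
(* Two edges from each of [u] and [v] into [S], and [uv] itself: ten in [e2], which balances the two
   new vertices. *)
have ev : e2 (u |: (v |: S)) = e2 S + 10.
  rewrite !e2U1 // Nu' N2 // TS2; clear; lia.
have cv : #|u |: (v |: S)| = #|S| + 2.
  by rewrite !cardsU1 uS' vS; clear; lia.
have Q2 : Q (u |: (v |: S)).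
  have AS2 : A \subset u |: (v |: S).
    by rewrite setUA; apply: subset_trans AS (subsetUr _ _).
  split=> //; last first.
  - by apply: (Puv S u v x y); rewrite // N2.
  - by rewrite ev cv; move: Sf; clear; lia.
  - rewrite ltnNge; apply/negP => le.
    have W : h <= #|u |: (v |: S)| <= 2 * h.
      by rewrite le cv; move: Sh h8; clear; lia.
    by have := sparser W; rewrite ev cv; move: Sf; clear; lia.
by move: uS; rewrite -(step _ Q2) ?setU11 // setUA subsetUr.
Qed.

Lemma nbr_idem v S : nbr v (nbr v S) = nbr v S.
Proof. by apply/setP => y; rewrite !inE; case: (y \in S); case: (adj v y). Qed.

Lemma card_cliques_bin r N : #|cliques r N| <= 'C(#|N|, r).
Proof.
rewrite -cards_draws; apply: subset_leq_card; apply/subsetP => t.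
by rewrite !inE => /and3P[-> ->].
Qed.

Lemma rainbow_small k S : #|S| < 4 -> rainbow_k4s k S = set0.
Proof.
move=> S4; apply/setP => T; rewrite !inE; apply/negP.
by move=> /and3P[/subset_leq_card le /andP[/eqP T4 _] _]; move: S4; rewrite ltnNge -T4 le.
Qed.

(** The excess falls from at most 8 to at least 1, so there are at most 6 neighbours. They contain
    no 4-clique, and [sparse] for [v] with its neighbourhood bounds their edges, excluding the
    octahedron. *)
Lemma triangles_at_vertex v S : v \notin S -> cliques 5 [set: V] = set0 -> #|v |: S| < h ->
  5 * #|S| <= e2 S + 8 -> 3 < #|nbr v S| -> #|cliques 3 (nbr v S)| <= 2 * #|nbr v S| - 6.
Proof.
move=> vS no5 vh Sf N3.
have vh0 : 0 < #|v |: S| < h by rewrite vh cardsU1 vS.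
have := sparse vh0; rewrite (e2U1 adj_sym adj_irr vS) cardsU1 vS => sp.
have N6 : #|nbr v S| <= 6 by move: sp Sf; clear; lia.
have vN : v \notin nbr v S by rewrite inE (negPf vS).
have vNh : 0 < #|v |: nbr v S| < h.
  by rewrite cardsU1 vN; move: N6 h8; clear; lia.
have := sparse vNh; rewrite (e2U1 adj_sym adj_irr vN) nbr_idem cardsU1 vN => spN.
apply: (card_triangles_le adj_sym adj_irr); first by rewrite N3 N6.
  apply/setP => t; rewrite !inE; apply/negP => /and3P[tN /eqP t4 /cliqueP tc].
  have vt : v \notin t by apply: contra vN; apply: (subsetP tN).
  move/setP/(_ (v |: t)): no5; rewrite !inE subsetT cardsU1 vt t4 /= => /negP; apply.
  have ad y : y \in t -> adj v y by move/(subsetP tN); rewrite inE => /andP[].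
  apply/cliqueP => x y /setU1P[->|xt] /setU1P[->|yt]; rewrite ?eqxx // => xy.
  - exact: ad.
  - by rewrite adj_sym ad.
  - exact: tc.
by move: spN N3 N6; clear; lia.
Qed.

(* Without a 5-clique: as long as the excess is 8 or 7, all 4-cliques repeat a colour and some
   vertex of every triangle is not bad, so one 4-clique at each new vertex can be made to
   repeat a colour. *)
Definition good S := exists k, [/\ colour_sym k, proper_on k S,
  #|rainbow_k4s k S| <= 6 - excess S, excess S = 8 -> no_two_bad adj k S
  & excess S = 7 -> no_three_bad adj k S].

Lemma good_vertex v S : v \notin S -> cliques 5 [set: V] = set0 -> #|v |: S| < h ->
  5 * #|S| <= e2 S + 8 -> 2 < #|nbr v S| -> good S -> good (v |: S).
Proof.
move=> vS no5 vh Sf N3 [k [ks kp kr k2 k3]].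
have cv : #|v |: S| = #|S| + 1 by rewrite cardsU1 vS addnC.
have ev := e2U1 adj_sym adj_irr vS.
have sp : e2 (v |: S) < 5 * #|v |: S|.
  by apply: sparse; rewrite vh cv addn1.
have tri3 : #|nbr v S| = 3 -> #|cliques 3 (nbr v S)| <= 1.
  by move=> N; have := card_cliques_bin 3 (nbr v S); rewrite N.
have tri4 := triangles_at_vertex vS no5 vh Sf.
set t := #|cliques 3 _| in tri3 tri4.
rewrite ev cv in sp.
(* With [d] neighbours the excess drops by [2 * d - 5]. At excess 7 or 8 no 4-clique is rainbow yet
   and one new one can be spared; below 7 the drop pays for all new triangles. *)
have [f7|f7] := leqP 7 (excess S).
  have n3 : no_three_bad adj k S.
    have [f8|f8] := eqVneq (excess S) 8; first exact/no_two_three/k2.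
    by apply: k3; move: f7 f8 Sf; rewrite /excess; clear; lia.
  have [k' [k's k'p k'r k'3]] := extend_paired adj_sym adj_irr vS ks kp n3.
  exists k'; split=> //; rewrite /excess ev cv.
  - apply: leq_trans k'r _; rewrite -/t.
    by move: kr tri3 tri4 sp N3 f7 Sf; rewrite /excess; move: t #|rainbow_k4s k S|; clear; lia.
  - by move: sp N3 Sf; clear; lia.
  - by move=> e; apply: k'3; apply: k2; move: e sp N3 Sf; rewrite /excess; clear; lia.
have [k' [k's k'p k'r _]] := extend_fresh adj_sym adj_irr vS ks kp.
exists k'; split=> //; rewrite /excess ev cv; last 2 first.
- by move: sp N3 f7; rewrite /excess; clear; lia.
- by move: sp N3 f7; rewrite /excess; clear; lia.
apply: leq_trans k'r _; rewrite -/t.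
by move: kr tri3 tri4 sp N3 f7 Sf; rewrite /excess; move: t #|rainbow_k4s k S|; clear; lia.
Qed.


Lemma proper_edge x y : adj x y -> proper_on (fun _ _ => 0) [set x; y].
Proof.
move=> xy a b c; rewrite !inE => /orP[]/eqP-> /orP[]/eqP-> /orP[]/eqP->; rewrite ?adj_irr ?eqxx //.
Qed.

Lemma colour_component_k5_free x0 y0 : adj x0 y0 -> cliques 5 [set: V] = set0 ->
  exists S, [/\ forall x y, adj x y -> x \in S, #|S| < h, 5 * #|S| <= e2 S + 8 & good S].
Proof.
move=> a0 no5; have n0 := adj_neq adj_irr a0.
have c0 : #|[set x0; y0]| = 2 by rewrite cards2 n0.
have e0 : e2 [set x0; y0] = 2.
  rewrite (e2U1 adj_sym adj_irr) ?inE // /e2 big_set1.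
  rewrite (_ : nbr y0 _ = set0); last first.
    by apply/setP => z; rewrite !inE; case: eqP => // ->; rewrite adj_irr.
  rewrite (_ : nbr x0 _ = [set y0]) ?cards0 ?cards1 //.
  by apply/setP => z; rewrite !inE; case: eqP => // ->; rewrite a0.
apply: (grow (P := good) (A := [set x0; y0]) _ _ a0); rewrite ?inE ?eqxx ?orbT ?c0 ?e0 //.
- exact: leq_trans h8.
- exists (fun _ _ => 0); split=> //; rewrite /excess ?c0 ?e0 //.
  + exact: proper_edge.
  + by rewrite rainbow_small ?cards0 // c0.
  + move=> _ x y z [[]]; rewrite !inE => /orP[]/eqP-> /orP[]/eqP-> /orP[]/eqP-> [];
      by rewrite ?adj_irr.
- by move=> S v _ Sf gS vS N3 vh; apply: good_vertex.
- move=> S u v x y uv uS vS auv axy Nu Nv e_eq c_eq [k [ks kp kr k2 k3]].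
  have [k' [k's k'p k'r k'2 k'3]] := extend_pair adj_sym adj_irr uv uS vS auv axy Nu Nv ks kp.
  have ex : excess (u |: (v |: S)) = excess S.
    by rewrite /excess e_eq c_eq; clear; lia.
  exists k'; split=> //; rewrite ex; first exact: leq_trans k'r kr.
    by move=> /k2 /k'2.
  by move=> /k3 /k'3.
Qed.

(* A 5-clique carries the colouring [i + j mod 5]; its excess is already 5 and no 4-clique
   is rainbow, which leaves one unit to spare for a later vertex joined to a 4-clique. *)
Definition good5 S := 5 * #|S| <= e2 S + 5 /\ exists k, [/\ colour_sym k, proper_on k S,
  #|rainbow_k4s k S| + excess S <= 6 & 2 < excess S -> #|rainbow_k4s k S| + excess S <= 5].

(** A 4-clique omits one index [i m]; among the other four, those at distance 1 and 4 from it, and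
    those at distance 2 and 3, have equal sums modulo 5. *)
Lemma colour_k5 (Q : {set V}) : #|Q| = 5 -> clique adj Q ->
  exists k, [/\ colour_sym k, proper_on k Q & rainbow_k4s k Q = set0].
Proof.
move=> Q5 Qc; pose i x := index x (enum Q).
have i5 x : x \in Q -> i x < 5 by rewrite -Q5 cardE index_mem mem_enum.
have iinj x y : x \in Q -> y \in Q -> i x = i y -> x = y.
  move=> xQ yQ e; rewrite -(nth_index x (s := enum Q) (x := x)) ?mem_enum //.
  by rewrite -[index x _]/(i x) e nth_index ?mem_enum.
exists (fun x y => (i x + i y) %% 5); split.
- by move=> x y; rewrite addnC.
- move=> x y z xQ yQ zQ _ _ /eqP yz /eqP; rewrite eqn_modDl !modn_small ?i5 //.
  by move=> /eqP /iinj e; apply: yz; apply: e.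
apply/setP => T; rewrite in_set0; apply/negP; rewrite in_set.
move=> /and3P[TQ /andP[/eqP T4 _] /negP]; apply.
have /card_gt0P[m] : 0 < #|Q :\: T| by rewrite cardsD (setIidPr TQ) Q5 T4.
rewrite inE => /andP[mT mQ].
pose n c := nth m (enum Q) ((i m + c) %% 5).
have lt c : (i m + c) %% 5 < size (enum Q) by rewrite -cardE Q5 ltn_mod.
have nQ c : n c \in Q by rewrite -mem_enum mem_nth.
have i_n c : i (n c) = (i m + c) %% 5 by rewrite /i index_uniq ?enum_uniq.
have n_inj c d : c < 5 -> d < 5 -> n c = n d -> c = d.
  move=> c5 d5 /(congr1 i); rewrite !i_n => /eqP; rewrite eqn_modDl !modn_small //.
  by move/eqP.
have TE : T = Q :\ m.
  apply/eqP; rewrite eqEcard subsetD1 TQ mT /=.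
  by have := cardsD1 m Q; rewrite mQ Q5 T4 add1n => -[<-].
have nT c : 0 < c < 5 -> n c \in T.
  move=> /andP[c0 c5]; rewrite TE !inE nQ andbT; apply: contraTneq c0 => e.
  suff -> : c = 0 by [].
  apply: n_inj => //; rewrite e; apply: iinj => //.
  by rewrite i_n addn0 modn_small // i5.
apply/repeatsP; exists (n 1), (n 4), (n 2), (n 3); split.
- by split; apply: nT.
- have neq c d : c < 5 -> d < 5 -> c != d -> n c != n d.
    by move=> c5 d5; apply: contraNneq => /n_inj ->.
  by rewrite /= !inE !negb_or !neq.
- rewrite !i_n !modnDm; congr (_ %% _); clear; lia.
Qed.

Lemma colour_component_k5 (Q : {set V}) : Q \in cliques 5 [set: V] ->
  exists S, [/\ forall x y, adj x y -> x \in S, #|S| < h, 5 * #|S| <= e2 S + 8 & good5 S].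
Proof.
rewrite inE => /and3P[_ /eqP Q5 Qc].
have /card_gt1P[x0 [y0 [x0Q y0Q n0]]] : 1 < #|Q| by rewrite Q5.
have a0 : adj x0 y0 by apply: (cliqueP _ _ Qc).
have eQ : e2 Q = 20.
  rewrite /e2 (eq_bigr (fun _ => 4)); first by rewrite sum_nat_const Q5.
  move=> x xQ; rewrite (_ : nbr x Q = Q :\ x).
    by have := cardsD1 x Q; rewrite xQ Q5 add1n => -[].
  apply/setP => y; rewrite !inE andbC; have [->|yx] /= := eqVneq y x; first by rewrite adj_irr.
  have [yQ|] := boolP (y \in Q); last by rewrite andbF.
  by rewrite andbT; apply: (cliqueP _ _ Qc); rewrite // eq_sym.
apply: (grow (P := good5) x0Q y0Q a0); rewrite ?Q5 ?eQ //.
- exact: leq_trans h8.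
- split; first by rewrite Q5 eQ.
  have [k [ks kp kr]] := colour_k5 Q5 Qc; exists k.
  by rewrite kr cards0 /excess Q5 eQ.
- move=> S v _ Sf [Sf5 [k [ks kp kr kr5]]] vS N3 vh.
  have cv : #|v |: S| = #|S| + 1 by rewrite cardsU1 vS addnC.
  have ev := e2U1 adj_sym adj_irr vS.
  have sp : e2 (v |: S) < 5 * #|v |: S|.
    by apply: sparse; rewrite vh cv addn1.
  rewrite ev cv in sp.
  have [k' [k's k'p k'r _]] := extend_fresh adj_sym adj_irr vS ks kp.
  (* The excess is at most 5 before this step and at least 1 after it. *)
  have N4 : #|nbr v S| <= 4 by move: sp Sf5; clear; lia.
  have bin : [\/ #|nbr v S| = 3 /\ #|cliques 3 (nbr v S)| <= 1
    | #|nbr v S| = 4 /\ #|cliques 3 (nbr v S)| <= 4].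
    have := card_cliques_bin 3 (nbr v S); move: N3 N4.
    by case: #|nbr v S| => [|[|[|[|[|d]]]]] // _ _ le; [left|right].
  move: k'r bin sp; set t := #|cliques 3 _|; set d := #|nbr v S| => k'r bin sp.
  split; first by rewrite ev cv; move: Sf5 N3; clear; lia.
  (* Three neighbours give one triangle for a drop of 1. Four give up to four triangles for a drop
     of 3: the excess was then at least 4, so the spare unit is available, and afterwards it is at
     most 2, where no spare is promised. *)
  exists k'; split=> //; rewrite /excess ev cv; move: bin k'r kr kr5 sp Sf5; rewrite /excess -/d;
    move: t d #|rainbow_k4s k S| #|rainbow_k4s k' _| => t d r r'; clear; lia.
- move=> S u v x y uv uS vS auv axy Nu Nv e_eq c_eq [Sf5 [k [ks kp kr kr5]]].
  have [k' [k's k'p k'r _ _]] := extend_pair adj_sym adj_irr uv uS vS auv axy Nu Nv ks kp.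
  have ex : excess (u |: (v |: S)) = excess S.
    by rewrite /excess e_eq c_eq; clear; lia.
  split; first by rewrite e_eq c_eq; move: Sf5; clear; lia.
  exists k'; split=> //; rewrite ex; first by apply: leq_trans kr; rewrite leq_add2r.
  by move=> /kr5; apply: leq_trans; rewrite leq_add2r.
Qed.

Lemma colour_component x0 y0 : adj x0 y0 ->
  exists S k, [/\ forall x y, adj x y -> x \in S, #|S| < h & 5 * #|S| <= e2 S + 8] /\
    [/\ colour_sym k, proper_on k S & #|rainbow_k4s k S| <= 6 - (5 * #|S| - e2 S)].
Proof.
move=> a0; have [no5|[Q Qc]] := set_0Vmem (cliques 5 [set: V]).
  by have [S [cov Sh Sf [k [ks kp kr _ _]]]] := colour_component_k5_free a0 no5; exists S, k.
have [S [cov Sh Sf [_ [k [ks kp kr _]]]]] := colour_component_k5 Qc; exists S, k; split=> //.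
by split=> //; move: kr; rewrite /excess; clear; lia.
Qed.

End Component.

(** * Combining the components *)

Lemma e2_sub (V : finType) (adj adj' : rel V) (A B : {set V}) :
  subrel adj adj' -> A \subset B -> e2 adj A <= e2 adj' B.
Proof.
move=> sub /subsetP AB; rewrite /e2 [X in _ <= X]big_mkcond [X in X <= _]big_mkcond.
apply: leq_sum => x _; case: ifP => // xA; rewrite AB //.
apply: subset_leq_card; apply/subsetP => y; rewrite !inE => /andP[yA xy].
by rewrite AB // sub.
Qed.

Section Global.
Variables (V : finType) (adj : rel V).
Hypothesis adj_sym : symmetric adj.
Hypothesis adj_irr : irreflexive adj.
Implicit Types (S T N : {set V}) (k : V -> V -> nat).
Implicit Types (C : {set {set V}}).
Variable h : nat.
Hypothesis h8 : 8 <= h.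
Hypothesis sparse : forall S, 0 < #|S| < h -> e2 adj S < 5 * #|S|.
Hypothesis sparser : forall S, h <= #|S| <= 2 * h -> e2 adj S + 8 < 5 * #|S|.

Definition share_edge : rel {set V} :=
  [rel T T' | [&& k4 adj T, k4 adj T' & 1 < #|T :&: T'|]].

Definition k4_class T : {set {set V}} := [set T' | connect share_edge T T'].

Definition k4_classes := [set k4_class T | T in [set T | k4 adj T]].

Definition class_adj (C : {set {set V}}) : rel V :=
  [rel x y | adj x y && [exists T in C, (x \in T) && (y \in T)]].

Lemma class_adjP C x y : reflect (adj x y /\ exists T, [/\ T \in C, x \in T & y \in T])
  (class_adj C x y).
Proof.
apply: (iffP andP) => -[xy].
  by move=> /exists_inP[T TC /andP[xT yT]]; split=> //; exists T.
by move=> [T [TC xT yT]]; split=> //; apply/exists_inP; exists T; rewrite // xT.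
Qed.

Lemma class_adj_sym C : symmetric (class_adj C).
Proof.
by move=> x y; apply/class_adjP/class_adjP => -[xy [T [TC xT yT]]]; rewrite adj_sym; split=> //; exists T.
Qed.

Lemma class_adj_irr C : irreflexive (class_adj C).
Proof. by move=> x; rewrite /class_adj /= adj_irr. Qed.

Lemma share_edge_sym : symmetric share_edge.
Proof. by move=> T T'; rewrite /share_edge /= setIC andbCA. Qed.

Lemma k4_in_class C T : C \in k4_classes -> T \in C -> k4 adj T.
Proof.
move=> /imsetP[T0]; rewrite inE => T04 ->; rewrite inE => con.
suff cl : closed share_edge [set T | k4 adj T].
  by have := closed_connect cl con; rewrite !inE T04 => <-.
by move=> X Y /and3P[X4 Y4 _]; rewrite !inE X4 Y4.
Qed.

Lemma card_meet_gt1 T T' x y : adj x y -> x \in T -> y \in T -> x \in T' -> y \in T' ->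
  1 < #|T :&: T'|.
Proof.
move=> xy xT yT xT' yT'; apply/card_gt1P; exists x, y.
by rewrite !inE xT yT xT' yT' (adj_neq adj_irr).
Qed.

Lemma class_closed C T T' : C \in k4_classes -> T \in C -> k4 adj T' -> 1 < #|T :&: T'| -> T' \in C.
Proof.
move=> CC TC T4' lt; have T4 := k4_in_class CC TC.
move: CC TC => /imsetP[T0 _ ->]; rewrite !inE => con.
by apply: connect_trans con (connect1 _); rewrite /share_edge /= T4 T4'.
Qed.

Lemma class_eq C T : C \in k4_classes -> T \in C -> C = k4_class T.
Proof.
move=> /imsetP[T0 _ ->]; rewrite inE => con; apply/setP => X; rewrite !inE.
by rewrite (same_connect (sym_connect_sym share_edge_sym) con).
Qed.

(** Two 4-cliques through a common edge are linked by [share_edge]. *)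
Lemma class_unique C C' x y : C \in k4_classes -> C' \in k4_classes ->
  class_adj C x y -> class_adj C' x y -> C = C'.
Proof.
move=> CC CC' /class_adjP[xy [T [TC xT yT]]] /class_adjP[_ [T' [TC' xT' yT']]].
rewrite (class_eq CC TC); apply/esym/class_eq => //.
apply: (class_closed CC' TC' (k4_in_class CC TC)).
exact: (card_meet_gt1 xy).
Qed.

Lemma class_k4 C T : C \in k4_classes -> k4 (class_adj C) T = (T \in C).
Proof.
move=> CC; apply/idP/idP => [/andP[T4 /cliqueP Tc]|TC].
  have aT x y : x \in T -> y \in T -> x != y -> adj x y by move=> xT yT xy; have /andP[] := Tc _ _ xT yT xy.
  have /card_gt1P[x [y [xT yT xy]]] : 1 < #|T| by rewrite (eqP T4).
  have /class_adjP[axy [T' [T'C xT' yT']]] := Tc _ _ xT yT xy.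
  apply: (class_closed CC T'C); last exact: card_meet_gt1 axy xT' yT' xT yT.
  by rewrite /k4 T4; apply/cliqueP.
have /andP[T4 /cliqueP Tc] := k4_in_class CC TC; rewrite /k4 T4 /=.
by apply/cliqueP => x y xT yT xy; apply/class_adjP; split; [apply: Tc|exists T].
Qed.

(** The 4-cliques of [C] inside [S] are closed under sharing an edge, and there is one at the given
    edge; hence all of [C] lies inside [S]. *)
Lemma class_connected C S : C \in k4_classes ->
  (exists x y, [/\ x \in S, y \in S & class_adj C x y]) ->
  (forall T, k4 (class_adj C) T -> 1 < #|T :&: S| -> T \subset S) ->
  forall x y, class_adj C x y -> x \in S.
Proof.
move=> CC [x0 [y0 [x0S y0S /class_adjP[a0 [T0 [T0C x0T y0T]]]]]] clo x y /class_adjP[_ [T [TC xT _]]].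
have T0S : T0 \subset S.
  by apply: clo; [rewrite class_k4|apply: card_meet_gt1 a0 _ _ _ _].
have cl : closed share_edge [set X in C | X \subset S].
  have half X Y : share_edge X Y -> X \in [set X in C | X \subset S] -> Y \in [set X in C | X \subset S].
    move=> /and3P[X4 Y4 lt]; rewrite !inE => /andP[XC XS].
    have YC := class_closed CC XC Y4 lt; rewrite YC clo ?class_k4 //.
    by apply: leq_trans lt _; rewrite setIC subset_leq_card // setIS.
  by move=> X Y XY; apply/idP/idP; apply: half => //; rewrite share_edge_sym.
have con : connect share_edge T0 T by move: TC; rewrite (class_eq CC T0C) inE.
have := closed_connect cl con; rewrite !inE T0C T0S TC /= => /esym /subsetP; exact.
Qed.

(** The implication sits under the existential, with a dummy value outside [k4_classes], so that
    [choice] applies. *)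
Lemma class_colouring C : exists (Sk : {set V} * (V -> V -> nat)), C \in k4_classes ->
  [/\ forall x y, class_adj C x y -> x \in Sk.1, 0 < #|Sk.1| < h
    & 5 * #|Sk.1| <= e2 (class_adj C) Sk.1 + 8] /\
  [/\ colour_sym Sk.2, proper_on (class_adj C) Sk.2 Sk.1
    & #|rainbow_k4s (class_adj C) Sk.2 Sk.1| <= 6 - (5 * #|Sk.1| - e2 (class_adj C) Sk.1)].
Proof.
have [CC|nC] := boolP (C \in k4_classes); last by exists (set0, fun _ _ => 0).
have sub : subrel (class_adj C) adj by move=> x y /andP[].
have sp S : 0 < #|S| < h -> e2 (class_adj C) S < 5 * #|S|.
  by move/sparse; apply: leq_ltn_trans; apply: e2_sub.
have sp' S : h <= #|S| <= 2 * h -> e2 (class_adj C) S + 8 < 5 * #|S|.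
  by move/sparser; apply: leq_ltn_trans; rewrite leq_add2r; apply: e2_sub.
have [T TC] : exists T, T \in C.
  by case/imsetP: CC => T _ ->; exists T; rewrite inE.
have /andP[T4 /cliqueP Tc] : k4 (class_adj C) T by rewrite class_k4.
have /card_gt1P[x [y [xT yT xy]]] : 1 < #|T| by rewrite (eqP T4).
have [S [k [[cov Sh Sf] H]]] := colour_component (class_adj_sym C) (class_adj_irr C) h8 sp sp'
  (fun S => class_connected CC) (Tc _ _ xT yT xy).
exists (S, k) => _ /=; split=> //; split=> //; rewrite Sh andbT.
by apply/card_gt0P; exists x; apply: cov (Tc _ _ xT yT xy).
Qed.

Lemma card_nbr v (adj' : rel V) S : #|nbr adj' v S| = \sum_(y in S) adj' v y.
Proof.
rewrite -sum1_card big_mkcond [RHS]big_mkcond; apply: eq_bigr => y _.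
by rewrite inE; case: (y \in S); case: (adj' v y).
Qed.

(** By [class_unique] no edge is counted for two classes. *)
Lemma sum_class_e2 (J : {set {set {set V}}}) W : J \subset k4_classes ->
  \sum_(C in J) e2 (class_adj C) W <= e2 adj W.
Proof.
move=> /subsetP JC; rewrite /e2 exchange_big; apply: leq_sum => x _.
under eq_bigr do rewrite card_nbr.
rewrite card_nbr exchange_big; apply: leq_sum => y _ /=.
have [/exists_inP[C CJ Cxy]|no] := boolP [exists C in J, class_adj C x y].
  rewrite (bigD1 C) //= big1 ?addn0; last first.
    move=> C' /andP[C'J CC']; case: (boolP (class_adj C' x y)) => // C'xy.
    by rewrite (class_unique (JC _ C'J) (JC _ CJ) C'xy Cxy) eqxx in CC'.
  by have /andP[-> _] := Cxy; apply: leq_b1.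
rewrite big1 // => C CJ; case: (boolP (class_adj C x y)) => // Cxy.
by case/negP: no; apply/exists_inP; exists C.
Qed.

Lemma global_colouring : exists k, [/\ colour_sym k, proper_on adj k [set: V]
  & forall T, k4 adj T -> repeats k T \/ exists x y, [/\ x \in T, y \in T, x != y & k x y = 0]].
Proof.
have [Sk HSk] := choice class_colouring.
pose S C := (Sk C).1; pose kC C := (Sk C).2.
pose w C := e2 (class_adj C) (S C).
pose Us C := rainbow_k4s (class_adj C) (kC C) (S C).
pose D := [set C in k4_classes | 5 * #|S C| <= w C + 5].
have DC C : C \in D -> C \in k4_classes by rewrite inE => /andP[].
have w_sum (J : {set {set {set V}}}) : J \subset D ->
    \sum_(C in J) w C <= e2 adj (\bigcup_(C in J) S C).
  move=> JD; apply: leq_trans (sum_class_e2 _ _); last first.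
    by apply: subset_trans JD _; apply/subsetP => C /DC.
  by apply: leq_sum => C CJ; apply: e2_sub => //; apply: bigcup_sup.
have W0 (J : {set {set {set V}}}) : J \subset D -> J != set0 -> 0 < #|\bigcup_(C in J) S C|.
  move=> JD /set0Pn[C CJ]; have [[_ /andP[S0 _] _] _] := HSk C (DC _ (subsetP JD _ CJ)).
  by apply: leq_trans S0 _; apply: subset_leq_card; apply: bigcup_sup.
have [||||||M [[M2 Mdis] _ Mhit]] := @cluster_matching V _ S w Us D h.
- by move=> C /DC CC; have [[_ /andP[_ Sh] _] _] := HSk C CC.
- by move=> C; rewrite inE => /andP[].
- move=> C; rewrite inE => /andP[CC]; have [_ [_ _]] := HSk C CC.
  rewrite /Us /w /S /kC; move: #|rainbow_k4s _ _ _| => r; clear; lia.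
- move=> C U CD; rewrite /Us inE => /and3P[US /andP[U4 _] _]; by rewrite US.
- move=> J JD J0 Wh; apply: leq_ltn_trans (w_sum J JD) _.
  by apply: sparse; rewrite W0.
- move=> J JD J0 Wh; apply: leq_ltn_trans (sparser Wh).
  by rewrite leq_add2r w_sum.
pose comp x y := [pick C in k4_classes | class_adj C x y].
(* An edge in a 4-clique is coded by its class and its colour there, any other edge by itself; hence
   colours never clash between classes. *)
pose code x y : {set {set V}} * nat + {set V} :=
  if comp x y is Some C then inl (C, kC C x y) else inr [set x; y].
(* The successor reserves colour 0 for the matching [M]. *)
exists (fun x y => if [set x; y] \in M then 0 else (pickle (code x y)).+1).
have comp_sym x y : comp x y = comp y x.
  by apply: eq_pick => C /=; rewrite class_adj_sym.
have compE C x y : C \in k4_classes -> class_adj C x y -> comp x y = Some C.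
  move=> CC Cxy; rewrite /comp; case: pickP => [C' /andP[CC' Cxy']|/(_ C)]; last by rewrite /= CC Cxy.
  by rewrite (class_unique CC CC' Cxy Cxy').
have set2I (x y z : V) : y != z -> [set x; y] != [set x; z].
  move=> yz; apply/eqP => E.
  have : y \in [set x; z] by rewrite -E !inE eqxx orbT.
  have : z \in [set x; y] by rewrite E !inE eqxx orbT.
  rewrite !inE [z == y]eq_sym (negPf yz) !orbF => /eqP zx /eqP yx.
  by rewrite yx zx eqxx in yz.
split.
- move=> x y; rewrite setUC; case: ifP => // _; congr (pickle _).+1.
  rewrite /code comp_sym setUC /comp; case: pickP => // C /andP[CC _].
  by have [_ [ks _ _]] := HSk C CC; rewrite /kC ks.
- move=> x y z _ _ _ xy xz yz.
  case: ifP => [xyM|_]; case: ifP => [xzM|_] //.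
    move=> _; have := Mdis _ _ xyM xzM (set2I x y z yz).
    by move/pred0P/(_ x); rewrite /= !inE eqxx.
  move=> [/(pcan_inj (@pickleK _))]; rewrite /code /comp.
  case: pickP => [C /andP[CC Cxy]|_]; case: pickP => [C' /andP[CC' Cxz]|_] //.
    move=> [CE]; subst C'; have [[cov _ _] [_ kp _]] := HSk C CC.
    have Cyx : class_adj C y x by rewrite class_adj_sym.
    have Czx : class_adj C z x by rewrite class_adj_sym.
    exact: (kp x y z (cov _ _ Cxy) (cov _ _ Cyx) (cov _ _ Czx) Cxy Cxz yz).
  by move=> [/eqP]; apply/negP; apply: set2I.
move=> T T4.
have TC : T \in k4_class T by rewrite inE.
have CC : k4_class T \in k4_classes by apply: imset_f; rewrite inE.
set C := k4_class T in TC CC.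
have /andP[_ /cliqueP Tc] : k4 (class_adj C) T by rewrite class_k4.
have [[cov _ Sf] [_ _ kr]] := HSk C CC.
(* A repetition may be destroyed by recolouring one of its edges to 0, but then the second
   alternative holds. *)
have [/repeatsP[a [b [c [d [[aT bT cT dT] u e]]]]]|nr] := boolP (repeats (kC C) T).
  have [ab cd] : a != b /\ c != d.
    by move: u; rewrite /= !inE !negb_or => /and4P[/andP[-> _] _ -> _].
  have [abM|abM] := boolP ([set a; b] \in M).
    by right; exists a, b; rewrite abM.
  have [cdM|cdM] := boolP ([set c; d] \in M).
    by right; exists c, d; rewrite cdM.
  left; apply/repeatsP; exists a, b, c, d; split=> //.
  by rewrite (negPf abM) (negPf cdM) /code !(compE C) ?e //; apply: Tc.
right; have TU : T \in Us C.
  rewrite inE nr andbT class_k4 // TC andbT; apply/subsetP => x xT.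
  have /card_gt0P[y] : 0 < #|T :\ x|.
    by have := cardsD1 x T; rewrite xT; case/andP: T4 => /eqP -> _; rewrite add1n => -[<-].
  rewrite !inE => /andP[yx yT]; apply: cov (Tc x y xT yT _).
  by rewrite eq_sym.
(* A rainbow 4-clique makes the bound [6 - excess] positive. *)
have CD : C \in D.
  rewrite inE CC /=; have : 0 < #|Us C| by apply/card_gt0P; exists T.
  move: kr Sf; rewrite -/(Us C) -/(S C) -/(w C); clear; lia.
have [e eM eT] := Mhit C T CD TU.
have /eqP/cards2P[x [y [xy eE]]] := M2 e eM; exists x, y; split=> //.
- by apply: (subsetP eT); rewrite eE !inE eqxx.
- by apply: (subsetP eT); rewrite eE !inE eqxx orbT.
- by rewrite -eE eM.
Qed.

End Global.

(** * The complete bipartite graph *)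

Definition lower_half n : {set 'I_n} := [set i : 'I_n | i < n./2].

Definition bipartite n : {set {set 'I_n}} :=
  [set e in pairs n | #|e :&: lower_half n| == 1%N].

Lemma card_bipartite n : n./2 * (n - n./2) <= #|bipartite n|.
Proof.
have cA : #|lower_half n| = n./2.
  have le : n./2 <= n by rewrite leq_half_double -addnn -addnS leq_addr.
  rewrite (_ : lower_half n = [set widen_ord le i | i : 'I_(n./2)]); last first.
    apply/setP => x; rewrite inE; apply/idP/imsetP => [lt|[i _ ->]]; last exact: (ltn_ord i).
    by exists (Ordinal lt) => //; apply: val_inj.
  by rewrite card_imset ?card_ord // => i j /(congr1 val) /= /val_inj.
have cB : #|~: lower_half n| = n - n./2 by have := cardsC (lower_half n); rewrite cA card_ord; lia.
rewrite -cB -cA -cardsX.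
rewrite -(card_in_imset (f := fun p : 'I_n * 'I_n => [set p.1; p.2])); last first.
  move=> [a b] [c d] /setXP[/= aA bA] /setXP[/= cA' dA] /= E.
  rewrite !in_setC in bA dA.
  have : a \in [set c; d] by rewrite -E set21.
  have : b \in [set c; d] by rewrite -E set22.
  rewrite !in_set2 => /orP[]/eqP eb /orP[]/eqP ea; rewrite ?eb ?ea // in aA bA *.
  - by rewrite cA' in bA.
  - by rewrite cA' in bA.
  - by rewrite aA in dA.
apply: subset_leq_card; apply/subsetP => e /imsetP[[a b] /setXP[/= aA bA] ->].
have ab : a != b by apply: contraTneq aA => ->; rewrite inE in bA.
rewrite !inE cards2 ab /=; apply/eqP; rewrite (_ : _ :&: _ = [set a]) ?cards1 //.
apply/setP => x; rewrite !inE in aA bA *.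
have [->|xa] /= := eqVneq x a; first by rewrite aA.
by have [->|//] := eqVneq x b; rewrite (negPf bA).
Qed.

(** * From the two halves to a colouring without rainbow 8-clique *)

Section Arrow.
Variables (n : nat) (F : {set {set 'I_n}}).
Hypothesis F_graph : F \subset pairs n.

Definition side_adj : rel 'I_n := fun x y =>
  [&& [set x; y] \in F, x != y & (x \in lower_half n) == (y \in lower_half n)].

Lemma side_adj_sym : symmetric side_adj.
Proof. by move=> x y; rewrite /side_adj setUC eq_sym [(_ \in _) == _]eq_sym. Qed.

Lemma side_adj_irr : irreflexive side_adj.
Proof. by move=> x; rewrite /side_adj eqxx andbF. Qed.

Lemma e2_side_adj S : e2 side_adj S <= 2 * #|[set e in F | e \subset S]|.
Proof.
rewrite (e2_cliques side_adj_sym side_adj_irr) leq_mul2l; apply/orP; right.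
apply: subset_leq_card; apply/subsetP => t; rewrite !inE => /and3P[tS /cards2P[x [y [xy tE]]] /cliqueP tc].
have axy : side_adj x y by apply: tc; rewrite // tE ?set21 ?set22.
by rewrite tS andbT tE; case/and3P: axy.
Qed.

Lemma in_bipartite x y : x != y ->
  ([set x; y] \in bipartite n) = ((x \in lower_half n) != (y \in lower_half n)).
Proof.
move=> xy; rewrite inE inE cards2 xy /= setIUl.
have I1 z : [set z] :&: lower_half n = if z \in lower_half n then [set z] else set0.
  apply/setP => w; rewrite in_setI in_set1; have [->|wz] /= := eqVneq w z.
    by case: ifP; rewrite ?set11 ?in_set0.
  by case: ifP; rewrite ?in_set1 ?(negPf wz) ?in_set0.
by rewrite !I1; case: (x \in _); case: (y \in _); rewrite ?setU0 ?set0U ?cards1 ?cards2 ?xy ?cards0.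
Qed.

Lemma no_rainbow_k8 k : colour_sym k -> proper_on side_adj k [set: 'I_n] ->
  (forall T, k4 side_adj T -> repeats k T \/ exists x y, [/\ x \in T, y \in T, x != y & k x y = 0]) ->
  ~ rbw_arrows_K (bipartite n :|: F) 8.
Proof.
move=> ks kp k4P arrows.
(* The symmetric colouring of vertex pairs is read off from edges; the value 0 on other sets is a
   dummy. *)
pose kk (e : {set 'I_n}) := if [pick p : 'I_n * 'I_n | e == [set p.1; p.2]] is Some p then k p.1 p.2 else 0.
have kkE x y : x != y -> kk [set x; y] = k x y.
  move=> xy; rewrite /kk; case: pickP => [[a b] /= /eqP E|/(_ (x, y))]; last by rewrite eqxx.
  have : x \in [set a; b] by rewrite -E !inE eqxx.
  have : y \in [set a; b] by rewrite -E !inE eqxx orbT.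
  by rewrite !in_set2 => /orP[]/eqP ey /orP[]/eqP ex; move: xy; rewrite ex ey ?eqxx // => _; rewrite ks.
(* Edges across the bipartition get private even colours. *)
pose c (e : {set 'I_n}) : nat := if e \in bipartite n then (enum_rank e).*2 else (kk e).*2.+1.
have cE x y : x != y -> (x \in lower_half n) = (y \in lower_half n) -> c [set x; y] = (k x y).*2.+1.
  by move=> xy side; rewrite /c in_bipartite // side eqxx kkE.
have side e : e \in F -> e \notin bipartite n -> exists x y, [/\ x != y, e = [set x; y], side_adj x y
    & (x \in lower_half n) = (y \in lower_half n)].
  move=> eF eB; have := subsetP F_graph e eF; rewrite inE => /cards2P[x [y [xy E]]].
  exists x, y; move: eB; rewrite E in_bipartite // negbK => /eqP s; split=> //.
  by rewrite /side_adj xy s eqxx -E eF.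
have cp : proper_colouring (bipartite n :|: F) c.
  move=> e f eE fE ef meet; rewrite /c; case: ifP => eB; case: ifP => fB.
  - by move=> /double_inj /val_inj /enum_rank_inj E; rewrite E eqxx in ef.
  - by move=> E; have := congr1 odd E; rewrite /= !odd_double.
  - by move=> E; have := congr1 odd E; rewrite /= !odd_double.
  move: eE fE; rewrite !in_setU eB fB /= => eF fF.
  have [x [y [xy eE exy _]]] := side e eF (negbT eB).
  have [z [w [zw fE fzw _]]] := side f fF (negbT fB).
  move=> -[/double_inj]; rewrite eE fE !kkE // => kE.
  have key a b d : side_adj a b -> side_adj a d -> [set a; b] != [set a; d] -> k a b <> k a d.
    move=> ab ad bd; apply: kp; rewrite ?inE //.
    by apply: contraNneq bd => ->.
  move: ef meet; rewrite eE fE => ef /pred0Pn[a /andP[]]; rewrite !inE.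
  have eyx : side_adj y x by rewrite side_adj_sym.
  have fwz : side_adj w z by rewrite side_adj_sym.
  move=> /orP[]/eqP ax /orP[]/eqP az; rewrite ax in az; rewrite -az in ef kE fzw fwz.
  - exact: (key x y w).
  - by apply: (key x y z); rewrite // 1?[[set x; z]]setUC // [k x z]ks.
  - by apply: (key y x w); rewrite // 1?[[set y; x]]setUC // [k y x]ks.
  - by apply: (key y x z); rewrite // 1?[[set y; x]]setUC 1?[[set y; z]]setUC // [k y x]ks [k y z]ks.
have [S [S8 [Scl Sinj]]] := arrows c cp.
have Sadj x y : x \in S -> y \in S -> x != y -> (x \in lower_half n) = (y \in lower_half n) -> side_adj x y.
  move=> xS yS xy s; have := Scl x y xS yS xy; rewrite in_setU in_bipartite // s eqxx /= => xyF.
  by rewrite /side_adj xyF xy s eqxx.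
have inj x y z w : x \in S -> y \in S -> z \in S -> w \in S -> x != y -> z != w ->
    c [set x; y] = c [set z; w] -> [set x; y] = [set z; w].
  move=> xS yS zS wS xy zw; apply: Sinj; rewrite !inE cards2 ?xy ?zw /=;
  by apply/subsetP => u; rewrite !inE => /orP[]/eqP->.
(* The special colour 0 becomes 1 under the odd encoding. A repeated colour is impossible inside the
   rainbow set [S], which leaves this alternative. *)
have zero (T : {set 'I_n}) b : T \subset S -> #|T| = 4 -> (forall x, x \in T -> (x \in lower_half n) = b) ->
    exists x y, [/\ x \in T, y \in T, x != y & c [set x; y] = 1].
  move=> TS T4 Tb; have TS' := subsetP TS.
  have T4' : k4 side_adj T.
    rewrite /k4 T4; apply/cliqueP => x y xT yT xy; apply: Sadj; rewrite ?TS' //.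
    by rewrite !Tb.
  case: (k4P T T4') => [/repeatsP[x [y [z [w [[xT yT zT wT] u E]]]]]|[x [y [xT yT xy k0]]]].
    move: u; rewrite /= !inE !negb_or => /and4P[/and3P[xy xz xw] /andP[yz yw] zw _].
    have := inj x y z w (TS' _ xT) (TS' _ yT) (TS' _ zT) (TS' _ wT) xy zw.
    rewrite !cE ?Tb // E => /(_ erefl) /setP/(_ x).
    by rewrite !inE eqxx (negPf xz) (negPf xw).
  by exists x, y; rewrite cE ?Tb // k0.
have sub4 (B : {set 'I_n}) m : m <= #|B| -> exists2 T : {set 'I_n}, T \subset B & #|T| = m.
  move=> le; have : 0 < #|[set T : {set 'I_n} | T \subset B & #|T| == m]|.
    by rewrite cards_draws bin_gt0.
  by move/card_gt0P => [T]; rewrite inE => /andP[TB /eqP]; exists T.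
(* After an edge [xy] of colour 1, the four vertices other than [x] provide a second one. *)
have five b (Q : {set 'I_n}) : Q \subset S -> (forall x, x \in Q -> (x \in lower_half n) = b) -> #|Q| <= 4.
  move=> QS Qb; rewrite leqNgt; apply/negP => /sub4[Q' Q'Q Q5].
  have Q'S := subset_trans Q'Q QS.
  have Q'b x : x \in Q' -> (x \in lower_half n) = b by move/(subsetP Q'Q)/Qb.
  have rm a : a \in Q' -> #|Q' :\ a| = 4.
    by move=> aQ; have := cardsD1 a Q'; rewrite aQ Q5 add1n => -[].
  have get a : a \in Q' -> exists x y, [/\ x \in Q' :\ a, y \in Q' :\ a, x != y & c [set x; y] = 1].
    move=> aQ; apply: (zero _ b); [|exact: rm|].
      by apply: subset_trans Q'S; apply: subsetDl.
    by move=> x /setD1P[_ /Q'b].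
  have /card_gt0P[a aQ] : 0 < #|Q'| by rewrite Q5.
  have [x [y [/setD1P[_ xQ] /setD1P[_ yQ] xy c0]]] := get a aQ.
  have [z [w [/setD1P[zx zQ] /setD1P[wx wQ] zw c0']]] := get x xQ.
  have sS u : u \in Q' -> u \in S by apply: (subsetP Q'S).
  have := inj x y z w (sS _ xQ) (sS _ yQ) (sS _ zQ) (sS _ wQ) xy zw.
  rewrite c0 c0' => /(_ erefl) /setP/(_ x).
  by rewrite !inE eqxx ![x == _]eq_sym (negPf zx) (negPf wx).
have cAB : #|S :&: lower_half n| + #|S :\: lower_half n| = 8.
  by rewrite cardsID.
have fA : #|S :&: lower_half n| <= 4.
  by apply: (five true); [apply: subsetIl|move=> x /setIP[]].
have fB : #|S :\: lower_half n| <= 4.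
  by apply: (five false); [apply: subsetDl|move=> x /setDP[_ /negPf]].
have [x [y [/setIP[xS xA] /setIP[yS yA] xy c0]]] :
    exists x y, [/\ x \in S :&: lower_half n, y \in S :&: lower_half n, x != y & c [set x; y] = 1].
  by apply: (zero _ true); [apply: subsetIl|lia|move=> u /setIP[]].
have [z [w [/setDP[zS zA] /setDP[wS wA] zw c0']]] :
    exists x y, [/\ x \in S :\: lower_half n, y \in S :\: lower_half n, x != y & c [set x; y] = 1].
  by apply: (zero _ false); [apply: subsetDl|lia|move=> u /setDP[_ /negPf]].
have := inj x y z w xS yS zS wS xy zw; rewrite c0 c0' => /(_ erefl) /setP/(_ x).
rewrite !inE eqxx /=; case: eqP => [xz|_]; first by rewrite -xz xA in zA.
by case: eqP => [xw|//]; first by rewrite -xw xA in wA.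
Qed.
End Arrow.

(** * The random graph *)

Section Thresholds.
Variable h : nat.

(* The number of edges [m] on [s] vertices for which [n ^ s * p ^ m] tends to 0: [5 s <= 2 m] for
   small [s], and only [5 s <= 2 m + 8] once [m] is large compared to [1 / eps]. *)
Definition edge_cap s := if s < h then uphalf (5 * s) else uphalf (5 * s - 8).

Definition locally_sparse n (F : {set {set 'I_n}}) := [forall S : {set 'I_n},
  (0 < #|S| <= 2 * h) ==> (#|[set e in F | e \subset S]| < edge_cap #|S|)].

Lemma locally_sparse_colouring n (F : {set {set 'I_n}}) : 8 <= h -> F \subset pairs n ->
  locally_sparse F -> ~ rbw_arrows_K (bipartite n :|: F) 8.
Proof.
move=> h8 FG /forallP sp.
have cap (S : {set 'I_n}) : 0 < #|S| <= 2 * h -> e2 (side_adj F) S + 2 <= 2 * edge_cap #|S|.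
  move=> S0; have /implyP/(_ S0) := sp S; have := e2_side_adj F S.
  by move: (e2 _ _) #|[set e in _ | _]| (edge_cap _); clear; lia.
(* Rounding up costs at most 1, while staying strictly below [edge_cap] gains 2 in [e2]; so both
   strict inequalities survive. *)
have up m : 2 * uphalf m <= m.+1.
  by rewrite uphalfE -{2}(odd_double_half m.+1) mul2n leq_addl.
have sp1 (S : {set 'I_n}) : 0 < #|S| < h -> e2 (side_adj F) S < 5 * #|S|.
  move=> /andP[S0 Sh]; have W : 0 < #|S| <= 2 * h by move: S0 Sh; clear; lia.
  by have := cap S W; have := up (5 * #|S|); rewrite /edge_cap Sh; clear; lia.
have sp2 (S : {set 'I_n}) : h <= #|S| <= 2 * h -> e2 (side_adj F) S + 8 < 5 * #|S|.
  move=> /andP[hS Sh]; have W : 0 < #|S| <= 2 * h by move: hS Sh h8; clear; lia.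
  have := cap S W; have := up (5 * #|S| - 8); rewrite /edge_cap (ltnNge #|S|) hS /=.
  by move: hS h8; move: (uphalf _); clear; lia.
have [k [ks kp k4P]] := global_colouring (side_adj_sym F) (side_adj_irr F) h8 sp1 sp2.
exact: (no_rainbow_k8 FG ks kp k4P).
Qed.

(** Exactly [edge_cap] edges are extracted, so that each witness [X] has probability
    [p ^+ edge_cap h #|S|]. *)
Lemma not_locally_sparse n (F : {set {set 'I_n}}) : ~~ locally_sparse F ->
  exists S : {set 'I_n}, 0 < #|S| <= 2 * h /\ exists X : {set {set 'I_n}},
    [/\ X \subset F, X \subset powerset S & #|X| = edge_cap #|S|].
Proof.
rewrite negb_forall => /existsP[S]; rewrite negb_imply -leqNgt => /andP[S0 le]; exists S; split=> //.
have : 0 < #|[set X : {set {set 'I_n}} | X \subset [set e in F | e \subset S] & #|X| == edge_cap #|S|]|.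
  by rewrite cards_draws bin_gt0.
move/card_gt0P => [X]; rewrite inE => /andP[/subsetP XF /eqP Xc]; exists X; split=> //.
  by apply/subsetP => e /XF; rewrite inE => /andP[].
by apply/subsetP => e /XF; rewrite !inE => /andP[].
Qed.
End Thresholds.

Local Open Scope ring_scope.

(** * The union bound in the binomial random graph *)

Section Gnp.
Variables (R : realType) (n : nat) (p : R).
Hypothesis p0 : 0 <= p.
Hypothesis p1 : p <= 1.

Definition gnp_weight (F : {set {set 'I_n}}) : R := p ^+ #|F| * (1 - p) ^+ (#|pairs n| - #|F|).

Lemma gnp_weight_ge0 F : 0 <= gnp_weight F.
Proof. by rewrite mulr_ge0 // exprn_ge0 // subr_ge0. Qed.

Lemma sum_gnp_weight (X : {set {set 'I_n}}) : X \subset pairs n ->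
  \sum_(F in powerset (pairs n) | X \subset F) gnp_weight F = p ^+ #|X|.
Proof.
move=> XP.
(* Factors for [e] in [F] and for [e] outside [F]. The zeros force [F] into [pairs n] and [X] into
   [F]; outside [X] the two factors sum to 1. *)
pose f (e : {set 'I_n}) : R := if e \in pairs n then p else 0.
pose g (e : {set 'I_n}) : R := if e \in X then 0 else if e \in pairs n then 1 - p else 1.
transitivity (\prod_(e : {set 'I_n}) (f e + g e)); last first.
  rewrite -prodr_const [RHS]big_mkcond; apply: eq_bigr => e _; rewrite /f /g.
  have [eX|eX] := boolP (e \in X); first by rewrite (subsetP XP) // addr0.
  by case: ifP => _; rewrite ?add0r // addrC subrK.
rewrite bigA_distr /= [LHS]big_mkcond /=; apply: eq_bigr => F _ /=.
rewrite inE; have [FP|FP] := boolP (F \subset pairs n); last first.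
  have /subsetPn[e eF eP] := FP.
  by rewrite (bigD1 e) //= eF /f (negPf eP) mul0r.
have [XF|XF] := boolP (X \subset F); last first.
  have /subsetPn[e eX eF] := XF.
  by rewrite (bigD1 e) //= (negPf eF) /g eX mul0r.
rewrite /= (bigID (mem F)) /= /gnp_weight; congr (_ * _).
  rewrite (eq_bigr (fun _ => p)); first by rewrite prodr_const.
  by move=> e eF; rewrite eF /f (subsetP FP).
have -> : (#|pairs n| - #|F|)%N = #|pairs n :\: F| by rewrite cardsD (setIidPr FP).
rewrite -prodr_const [RHS]big_mkcond [LHS]big_mkcond.
apply: eq_bigr => e _; rewrite in_setD; have [eF|eF] //= := boolP (e \in F).
by rewrite /g; have [eX|//] := boolP (e \in X); case/negP: eF; apply: (subsetP XF).
Qed.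

Lemma gnp_prob_le1 (P : {set {set 'I_n}} -> Prop) : gnp_prob p P <= 1.
Proof.
have := sum_gnp_weight (sub0set (pairs n)); rewrite cards0 expr0 => <-.
rewrite (eq_bigl (fun F => F \in powerset (pairs n))); last by move=> F; rewrite sub0set andbT.
by apply: ler_sum => F _; case: ifP => _ //; apply: gnp_weight_ge0.
Qed.

(** Union bound over the vertex sets [S] and the families [X] of subsets of [S], of which there are
    at most [2 ^ 2 ^ #|S|]. *)
Lemma gnp_prob_sparse (h : nat) (P : {set {set 'I_n}} -> Prop) :
  (forall F : {set {set 'I_n}}, F \subset pairs n -> locally_sparse h F -> P F) ->
  1 - \sum_(S : {set 'I_n} | (0 < #|S| <= 2 * h)%N)
        (2 ^ 2 ^ #|S|)%:R * p ^+ edge_cap h #|S| <= gnp_prob p P.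
Proof.
move=> sub.
pose B (S : {set 'I_n}) := [set X in powerset (powerset S) | X \subset pairs n & #|X| == edge_cap h #|S|].
pose bad (S : {set 'I_n}) := (0 < #|S| <= 2 * h)%N.
have le1 : \sum_(S | bad S) \sum_(X in B S) \sum_(F in powerset (pairs n) | X \subset F) gnp_weight F
    <= \sum_(S | bad S) (2 ^ 2 ^ #|S|)%:R * p ^+ edge_cap h #|S|.
  apply: ler_sum => S _.
  rewrite (eq_bigr (fun=> p ^+ edge_cap h #|S|)); last first.
    by move=> X; rewrite !inE => /and3P[_ XP /eqP <-]; apply: sum_gnp_weight.
  rewrite sumr_const -[X in X <= _]mulr_natl ler_wpM2r ?exprn_ge0 // ler_nat -!card_powerset.
  by apply: subset_leq_card; apply/subsetP => X; rewrite inE => /andP[].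
rewrite lerBlDr; apply: le_trans (lerD (lexx _) le1).
have <- : \sum_(F in powerset (pairs n)) gnp_weight F = 1.
  have := sum_gnp_weight (sub0set (pairs n)); rewrite cards0 expr0 => <-.
  by apply: eq_bigl => F; rewrite sub0set andbT.
have inner S : \sum_(X in B S) \sum_(F in powerset (pairs n) | X \subset F) gnp_weight F
    = \sum_(F in powerset (pairs n)) \sum_(X in B S | X \subset F) gnp_weight F.
  rewrite (exchange_big_dep (mem (powerset (pairs n)))) /=; last by move=> X F _ /andP[].
  by apply: eq_bigr => F FP; apply: eq_bigl => X; rewrite FP.
rewrite [X in _ <= _ + X](eq_bigr _ (fun S _ => inner S)).
rewrite [X in _ <= _ + X]exchange_big /= /gnp_prob -big_split /=; apply: ler_sum => F FP.
have w0 := gnp_weight_ge0 F.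
have s0 : 0 <= \sum_(S | bad S) \sum_(X in B S | X \subset F) gnp_weight F.
  by do 2 (apply: sumr_ge0 => ? _).
case: ifP => [_|/asboolPn nP]; first by rewrite lerDl.
rewrite add0r; have [lsF|] := boolP (locally_sparse h F).
  by case: nP; apply: sub => //; move: FP; rewrite inE.
move=> /not_locally_sparse[S [S0 [X [XF XS Xc]]]].
have XB : X \in B S.
  by rewrite !inE XS Xc eqxx andbT (subset_trans XF) //; move: FP; rewrite inE.
rewrite (bigD1 S) //= (bigD1 X) /=; last by rewrite XB.
rewrite -addrA lerDl addr_ge0 //; last by do 2 (apply: sumr_ge0 => ? _).
by apply: sumr_ge0.
Qed.
End Gnp.

Lemma bin_le_expn n s : ('C(n, s) <= n ^ s)%N.
Proof.
have ffact_le : (n ^_ s <= n ^ s)%N.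
  by elim: s => [|s IH]; rewrite ?ffactnSr ?expnSr // leq_mul ?leq_subr.
by apply: leq_trans ffact_le; rewrite -bin_ffact leq_pmulr // fact_gt0.
Qed.

(** * The first moment tends to zero *)

Section Limit.
Variables (R : realType) (eps : R).
Hypothesis eps0 : 0 < eps.

(** The exponent [s - m * (2 / 5 + eps)] is at most [- eps]: either [5 * s <= 2 * m] and [m >= 1],
    or [s] exceeds [2 * m / 5] by at most [8 / 5], which [m >= h] absorbs into [m * eps]. *)
Lemma first_moment_term (h n s : nat) : (8 <= h)%N -> 8 / (5 * eps) + 1 <= h%:R ->
  (0 < n)%N -> (0 < s)%N ->
  (n ^ s)%:R * ((n%:R : R) `^ (- (2 / 5 + eps))) ^+ edge_cap h s <= n%:R `^ (- eps).
Proof.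
move=> h8 heps n0 s0; have n1 : 1 <= n%:R :> R by rewrite ler1n.
set m := edge_cap h s.
rewrite natrX -!powR_mulrn ?powR_ge0 ?ler0n // -powRrM -powRD; last first.
  by rewrite pnatr_eq0 -lt0n n0 implybT.
apply: (ler_powR n1).
have up k : (k <= 2 * uphalf k)%N.
  by rewrite mul2n -leq_uphalf_double.
have em1 : (5 * s <= 2 * m)%N \/ (5 * s <= 2 * m + 8)%N /\ (h <= m)%N.
  rewrite /m /edge_cap; case: ltnP => hs; first by left; apply: up.
  by right; have := up (5 * s - 8)%N; move: (uphalf _) h8 hs; clear; lia.
have ez : 8 / (5 * eps) * (5 * eps) = 8 by field; rewrite gt_eqF.
case: em1 => [em|[em hm]].
  have em' : 5 * s%:R <= 2 * m%:R :> R by rewrite -!natrM ler_nat.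
  have m1 : 1 <= m%:R :> R by rewrite ler1n; move: em s0; clear; lia.
  have em2 : eps * 1 <= eps * m%:R by rewrite ler_pM2l.
  by lra.
have em' : 5 * s%:R <= 2 * m%:R + 8 :> R by rewrite -!natrM -natrD ler_nat.
have hm' : h%:R <= m%:R :> R by rewrite ler_nat.
have : (8 / (5 * eps) + 1) * (5 * eps) <= m%:R * (5 * eps).
  by rewrite ler_pM2r ?mulr_gt0 // (le_trans heps).
by rewrite mulrDl ez; lra.
Qed.

Lemma first_moment_le (h n : nat) : (8 <= h)%N -> 8 / (5 * eps) + 1 <= h%:R -> (0 < n)%N ->
  \sum_(S : {set 'I_n} | (0 < #|S| <= 2 * h)%N)
    (2 ^ 2 ^ #|S|)%:R * ((n%:R : R) `^ (- (2 / 5 + eps))) ^+ edge_cap h #|S|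
  <= ((2 * h).+1 * 2 ^ 2 ^ (2 * h))%:R * n%:R `^ (- eps).
Proof.
move=> h8 heps n0; set p := _ `^ _.
pose q := n%:R `^ (- eps) : R.
(* Grouping by size leaves [(2 * h).+1] classes, each contributing at most a constant times [q], as
   there are at most [n ^ s] sets of size [s]. *)
rewrite (partition_big (fun S : {set 'I_n} => inord #|S| : 'I_(2 * h).+1) xpredT) //=.
rewrite natrM -mulrA -[(2 * h).+1 in X in _ <= X]card_ord -sumr_const mulr_suml.
apply: ler_sum => s _.
have [s0|s0] := posnP s.
  rewrite big1 ?mul1r ?mulr_ge0 ?powR_ge0 // => S /andP[/andP[S0 Sh] /eqP E].
  by move: S0; rewrite -(@inordK (2 * h) #|S|) // E s0.
rewrite mul1r; apply: le_trans (_ : \sum_(S : {set 'I_n} | #|S| == s) (2 ^ 2 ^ (2 * h))%:R * p ^+ edge_cap h s <= _).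
  rewrite [X in X <= _]big_mkcond [X in _ <= X]big_mkcond; apply: ler_sum => S _ /=.
  case: ifP => [/andP[/andP[S0 Sh] /eqP E]|_]; last first.
    by case: ifP => _; rewrite ?mulr_ge0 ?exprn_ge0 ?powR_ge0.
  have <- : #|S| = s by rewrite -E inordK.
  rewrite eqxx ler_wpM2r ?exprn_ge0 ?powR_ge0 // ler_nat.
  by rewrite !leq_exp2l.
rewrite sumr_const -[X in X <= _]mulr_natl.
have -> : #|(fun S : {set 'I_n} => #|S| == s)| = 'C(n, s).
  by have := card_draws 'I_n s; rewrite card_ord cardsE.
rewrite mulrCA ler_wpM2l ?ler0n //.
apply: le_trans (first_moment_term h8 heps n0 s0).
by rewrite ler_wpM2r ?exprn_ge0 ?powR_ge0 // ler_nat bin_le_expn.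
Qed.

Lemma powR_natN_cvg0 : (n%:R `^ (- eps) @[n --> \oo] --> (0 : R))%classic.
Proof.
apply/cvgrPdist_lt => e e0; near=> n.
rewrite sub0r normrN ger0_norm ?powR_ge0 //.
have n0 : 0 < n%:R :> R by rewrite ltr0n; near: n; exists 1%N.
rewrite powRN invf_plt ?posrE ?powR_gt0 //.
have -> : e^-1 = (e^-1 `^ eps^-1) `^ eps.
  by rewrite -powRrM mulVf ?gt_eqF // powRr1 // invr_ge0 ltW.
rewrite gt0_ltr_powR ?nnegrE ?powR_ge0 ?ler0n //.
near: n; exists (Num.bound (e^-1 `^ eps^-1)) => // n /= le.
by apply: lt_le_trans (archi_boundP (powR_ge0 _ _)) _; rewrite ler_nat.
Unshelve. all: by end_near.
Qed.
End Limit.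

Lemma bipartite_dense {R : realType} (d : R) n : 0 < d -> d <= 1 / 2 -> in_dense_family d (bipartite n).
Proof.
move=> d0 d2; split; first by apply/subsetP => e; rewrite inE => /andP[].
apply: le_trans (_ : 1 / 2 * 'C(n, 2)%:R <= _); first by rewrite ler_wpM2r.
have : ('C(n, 2) <= 2 * #|bipartite n|)%N.
  apply: leq_trans (leq_mul (leqnn 2) (card_bipartite n)).
  rewrite bin2 leq_half_double.
  have := odd_double_half n; move: (n./2) => m; case: (odd n) => <-; nia.
rewrite -(ler_nat R) natrM; lra.
Qed.

Local Open Scope classical_set_scope.

Theorem theorem1p4 (R : realType) (d eps : R) :
  0 < d -> d <= 1 / 2 -> 0 < eps ->
  exists G : forall n : nat, {set {set 'I_n}},
    (forall n, in_dense_family d (G n)) /\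
    gnp_prob (powR (n%:R : R) (- (2 / 5 + eps)))
      (fun F => ~ rbw_arrows_K (G n :|: F) 8) @[n --> \oo] --> (1 : R).
Proof.
move=> d0 d2 eps0; exists bipartite; split=> [n|]; first exact: bipartite_dense.
(* The 8 serves the colouring argument, the other summand the exponent estimate. *)
pose h := (8 + Num.bound (8 / (5 * eps) + 1))%N.
have h8 : (8 <= h)%N by apply: leq_addr.
have heps : 8 / (5 * eps) + 1 <= h%:R.
  have a0 : 0 <= 8 / (5 * eps) + 1 :> R by rewrite addr_ge0 // divr_ge0 // mulr_ge0 // ltW.
  by rewrite /h natrD; have := archi_boundP a0; lra.
pose C : R := ((2 * h).+1 * 2 ^ 2 ^ (2 * h))%:R.
apply: (@squeeze_cvgr _ _ _ _ (fun n => 1 - C * n%:R `^ (- eps)) (fun=> 1)); last 2 first.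
- rewrite -[X in _ --> X]subr0 -[X in _ --> _ - X](mulr0 C).
  by apply: cvgB; [exact: cvg_cst|apply: cvgMr; exact: powR_natN_cvg0].
- exact: cvg_cst.
near=> n.
have n0 : (0 < n)%N by near: n; exists 1%N.
have p0 := powR_ge0 (n%:R : R) (- (2 / 5 + eps)).
have p1 : n%:R `^ (- (2 / 5 + eps)) <= 1 :> R.
  rewrite -[X in _ <= X](powRr0 (n%:R : R)); apply: ler_powR; first by rewrite ler1n.
  by rewrite oppr_le0 addr_ge0 // ltW.
rewrite gnp_prob_le1 // andbT.
apply: le_trans (gnp_prob_sparse (h := h) p0 p1 _); last first.
  by move=> F FG ls; apply: locally_sparse_colouring ls.
by rewrite lerD2l lerN2 first_moment_le.
Unshelve. all: by end_near.
Qed.
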